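(* Let $d \in \mathbb{N}$, let $n \in \mathbb{N}$ be any odd number such that $n \geq 3$, and let $u^{\mathrm{in}} \in L^{n}(\mathbb{T}^{d})$. Then a weak solution $u \in L^{n}(0,\infty; L^{n}(\mathbb{T}^{d}))$ to $$\partial_{t} u + u^{n} = \Delta u \ \text{ on } (0,\infty)\times\mathbb{T}^{d}, \qquad u|_{t=0} = u^{\mathrm{in}},$$ is unique. That is, if $u_{1}, u_{2} \in L^{n}(0,\infty; L^{n}(\mathbb{T}^{d}))$ are both weak solutions with the same initial data $u^{\mathrm{in}}$, then $u_{1} = u_{2}$ almost everywhere on $(0,\infty) \times \mathbb{T}^{d}$.
   Context: $\mathbb{N} = \{1,2,\dots\}$ and $\mathbb{T}^{d}$ is the $d$-dimensional torus; all functions are real-valued. Definition (weak solution). Given initial data $u^{\mathrm{in}} \in L^{n}(\mathbb{T}^{d})$, a scalar field $u \in L^{n}(0,\infty; L^{n}(\mathbb{T}^{d}))$ is a weak solution to $\partial_{t} u + u^{n} = \Delta u$, $u|_{t=0} = u^{\mathrm{in}}$, if for every $T > 0$ and every test function $\psi \in C_{c}^{\infty}((-\infty,T) \times \mathbb{T}^{d})$, for almost every $t \in (0,T)$, $$\int_{\mathbb{T}^{d}} u(t,x) \psi(t,x)\, dx - \int_{\mathbb{T}^{d}} u^{\mathrm{in}}(x) \psi(0,x)\, dx - \int_{0}^{t} \int_{\mathbb{T}^{d}} u(s,x) \partial_{s} \psi(s,x)\, dx\, ds + \int_{0}^{t} \int_{\mathbb{T}^{d}} u^{n}(s,x) \psi(s,x)\,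 dx\, ds = \int_{0}^{t} \int_{\mathbb{T}^{d}} u(s,x) \Delta \psi(s,x)\, dx\, ds.$$ *)

(* Defs.v *)
From HB Require Import structures.
From mathcomp Require Import all_boot all_order all_algebra.
From mathcomp Require Import all_classical all_reals all_analysis.

Set Implicit Arguments.
Unset Strict Implicit.
Unset Printing Implicit Defensive.

Import Order.TTheory GRing.Theory Num.Theory.
Import numFieldNormedType.Exports.

Local Open Scope classical_set_scope.
Local Open Scope ring_scope.

(* The torus T^d is R^d / Z^d.  A scalar field on it is represented by its
   restriction to the fundamental cube [0, 1]^d, that is, by a function on
   R^d considered modulo the measure torus_measure below, which is
   concentrated on that cube.  Functions for which pointwise values matter
   (the test functions) are Z^d-periodic functions on R^d. *)

(* d-tuples of reals with the product Borel sigma-algebra; measurableTypeR R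
   is R itself, with the sigma-algebra over which lebesgue_measure and
   uniform_prob are stated. *)
Notation Rpt R d := (d.-tuple (measurableTypeR R)).

Section torus_measure.
Variable R : realType.

Definition cons_pt d (z : measurableTypeR R * Rpt R d) : Rpt R d.+1 :=
  [the d.+1.-tuple (measurableTypeR R) of z.1 :: z.2].

Lemma measurable_cons_pt d : measurable_fun setT (@cons_pt d).
Proof. exact: measurable_cons. Qed.

HB.instance Definition _ d :=
  isMeasurableFun.Build _ _ _ _ (@cons_pt d) (@measurable_cons_pt d).

(* The d-fold product of the uniform probability on [0, 1], i.e. the
   normalized Lebesgue (Haar) measure of the torus. *)
Fixpoint torus_measure d : probability (Rpt R d) R :=
  match d with
  | 0 => [the probability _ R of \d_([tuple] : Rpt R 0)]
  | d'.+1 => [the probability _ R of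
      distribution [the probability _ R of
          (uniform_prob (@ltr01 R) \x torus_measure d')%E] (@cons_pt d')]
  end.

Lemma torus_measure_box d (B : 'I_d -> set (measurableTypeR R)) :
  (forall i, measurable (B i)) ->
  torus_measure d [set x | forall i, B i (tnth x i)] =
  (\prod_(i < d) uniform_prob (@ltr01 R) (B i))%E.
Proof.
elim: d B => [|d IH] B mB.
  rewrite big_ord0 /= /dirac indicE mem_set //. by case.
rewrite big_ord_recl /= -(IH (fun i => B (lift ord0 i)))//.
rewrite /distribution /pushforward /= -product_measure1E//=; last first.
  rewrite (_ : [set _ | _] = \bigcap_i ((fun x => @tnth _ (measurableTypeR R) x i) @^-1` B (lift ord0 i))); last first.
    by apply/seteqP; split => x /=; [move=> h i _; exact: h|move=> h i; exact: h].
  apply: fin_bigcap_measurable => // i _.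
  rewrite -[X in measurable X]setTI. exact: measurable_tnth.
congr (product_measure1 _ _ _).
apply/seteqP; split => -[a x] /=.
  move=> h; split; first exact: (h ord0).
  by move=> i; have := h (lift ord0 i); rewrite tnthS.
move=> [ha h] i; case: (unliftP ord0 i) => [j ->|->]; last by [].
by rewrite tnthS; exact: h.
Qed.

End torus_measure.

Section smooth.
Variables (R : realType) (V : normedModType R).

Fixpoint Ck (k : nat) (f : V -> R) : Prop :=
  match k with
  | 0 => continuous f
  | k'.+1 => (forall z, differentiable f z) /\ forall v, Ck k' ('D_v f)
  end.

Definition smooth (f : V -> R) : Prop := forall k, Ck k f.

End smooth.

Section weak_solution.
Variables (R : realType) (d : nat).

Definition row_of_pt (x : Rpt R d) : 'rV[R]_d := \row_i tnth x i.

(* psi is an element of C_c^oo((-oo, T) x T^d), extended by 0 to R x T^d and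
   lifted to R x R^d; as T^d is compact, the support condition only concerns
   the time variable. *)
Record test_function (T : R) (psi : R * 'rV[R]_d -> R) : Prop := {
  test_smooth : smooth psi;
  test_periodic : forall t x (i : 'I_d),
    psi (t, x + delta_mx 0 i) = psi (t, x);
  test_support : exists a b : R, b < T /\
    forall t x, psi (t, x) != 0 -> a <= t <= b }.

Definition dtime (psi : R * 'rV[R]_d -> R) : R * 'rV[R]_d -> R :=
  'D_((1, 0) : R * 'rV[R]_d) psi.

Definition dspace (i : 'I_d) (psi : R * 'rV[R]_d -> R) : R * 'rV[R]_d -> R :=
  'D_((0, delta_mx 0 i) : R * 'rV[R]_d) psi.

Definition laplacian (psi : R * 'rV[R]_d -> R) (z : R * 'rV[R]_d) : R :=
  \sum_(i < d) dspace i (dspace i psi) z.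

Definition in_Ln (n : nat) (f : Rpt R d -> R) : Prop :=
  f \in Lfun (torus_measure R d) n%:R%:E.

(* L^n(0, oo; L^n(T^d)): jointly measurable representatives whose
   spatial L^n norm is in L^n(0, oo). *)
Definition in_LnLn (n : nat) (u : measurableTypeR R -> Rpt R d -> R) : Prop :=
  measurable_fun [set z : measurableTypeR R * Rpt R d | 0 < z.1]
    (fun z => u z.1 z.2) /\
  (\int[lebesgue_measure]_(t in `]0%R, +oo[)
     (Lnorm (torus_measure R d) n%:R%:E (EFin \o u t)) `^ n%:R < +oo)%E.

Definition weak_solution (n : nat) (uin : Rpt R d -> R)
    (u : measurableTypeR R -> Rpt R d -> R) : Prop :=
  in_LnLn n u /\
  forall T : R, 0 < T -> forall psi, test_function T psi ->
  {ae @lebesgue_measure R, forall t : measurableTypeR R, t \in `]0, T[ ->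
    \int[torus_measure R d]_x (u t x * psi (t, row_of_pt x))
    - \int[torus_measure R d]_x (uin x * psi (0, row_of_pt x))
    - \int[lebesgue_measure]_(s in `]0, t[)
        (\int[torus_measure R d]_x (u s x * dtime psi (s, row_of_pt x)))
    + \int[lebesgue_measure]_(s in `]0, t[)
        (\int[torus_measure R d]_x (u s x ^+ n * psi (s, row_of_pt x)))
    = \int[lebesgue_measure]_(s in `]0, t[)
        (\int[torus_measure R d]_x (u s x * laplacian psi (s, row_of_pt x)))}.

End weak_solution.

(* Main.v *)
From HB Require Import structures.
Require Import Defs.
From mathcomp Require Import all_boot all_order all_algebra.
From mathcomp Require Import all_classical all_reals all_analysis.
From mathcomp Require Import measurable_realfun ring lra.
Set Implicit Arguments.
Unset Strict Implicit.
Unset Printing Implicit Defensive.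
Import Order.TTheory GRing.Theory Num.Theory.
Import numFieldNormedType.Exports.
Local Open Scope classical_set_scope.
Local Open Scope ring_scope.

(** The proof is an L^1-type energy argument. Put w = u1 - u2 and
    f = u1^n - u2^n. As n is odd, w f >= 0, and w solves dw/dt = Laplace w - f
    with zero initial value. Formally, multiplying by beta(w), where
    beta(r) = r / sqrt(1 + r^2) is the derivative of the convex function
    jap(r) = sqrt(1 + r^2), and integrating over the torus shows that the
    integral of jap(w) cannot increase, so that w = 0. Since w is merely in L^n
    and f merely in L^1, the computation is performed on smoothed functions.

    Localisation in time: w is multiplied by a smooth cutoff chi that decreases
    strictly on (0, c) and vanishes after c. Then W = chi w solves the heat
    equation with source - g, where g = chi f - chi' w, and it vanishes both at
    time 0 and after time c. The terms chi f beta(W) and - chi' w beta(W) are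
    both nonnegative, and on (0, c) the second one vanishes only where w = 0. It is
    therefore enough to show that the integral of g beta(W) over space and time
    is at most 0; there is no energy left at the end points to keep track of.

    Smoothing in space: K is the product of Fejer kernels in the coordinates.
    It is a smooth nonnegative periodic kernel of mass one, so chi times
    y |-> K (x - y) is an admissible test function for every fixed x
    (test_function_tensor), and the weak formulation says that t |-> K W (t, x)
    is the primitive of an integrable function. The chain rule
    jap_primitive_le, integrated over x, and the dissipation inequality
    torus_dissipation, an integration by parts on each circle, show that the
    integral of (K g) beta(K W) is at most 0 (energy_estimate).

    Limit: the Fejer kernels form an approximate identity in L^1. This is
    proved on the circle by Korovkin's argument (approx_id_fejer) and passes to
    the torus and to space-time by taking tensor products and fibres
    (approx_id_torus, ai_cvg_slices). As beta is bounded and Lipschitz,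
    (K g) beta(K W) may be replaced by g beta(W) in the limit (beta_limit). *)

(** * Integrable real functions and Fubini's theorem *)

Definition L1 {d} {T : measurableType d} {R : realType}
    (mu : {measure set T -> \bar R}) (f : T -> R) : Prop :=
  mu.-integrable setT (EFin \o f).

Section L1_theory.
Context {d} {T : measurableType d} {R : realType}.
Variable mu : {measure set T -> \bar R}.
Implicit Types f g h : T -> R.

Lemma L1_measurable f : L1 mu f -> measurable_fun setT f.
Proof. by move=> /integrableP[/measurable_EFinP]. Qed.

Lemma L1D f g : L1 mu f -> L1 mu g -> L1 mu (fun x => f x + g x).
Proof.
move=> If Ig; have := integrableD measurableT If Ig.
by apply: eq_integrable => // x _.
Qed.

Lemma L1B f g : L1 mu f -> L1 mu g -> L1 mu (fun x => f x - g x).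
Proof.
move=> If Ig; have := integrableB measurableT If Ig.
by apply: eq_integrable => // x _.
Qed.

Lemma L1Z k f : L1 mu f -> L1 mu (fun x => k * f x).
Proof.
move=> If; have := integrableZl measurableT k If.
by apply: eq_integrable => // x _.
Qed.

Lemma L1_norm f : L1 mu f -> L1 mu (fun x => `|f x|).
Proof. exact: integrable_norm. Qed.

Lemma le_L1 f g : measurable_fun setT f -> (forall x, `|f x| <= g x) ->
  L1 mu g -> L1 mu f.
Proof.
move=> mf fg; apply: le_integrable => //; first exact/measurable_EFinP.
by move=> x _ /=; rewrite lee_fin (le_trans (fg x))// ler_norm.
Qed.

Lemma L1_bddM C h f : measurable_fun setT h -> (forall x, `|h x| <= C) ->
  L1 mu f -> L1 mu (fun x => f x * h x).
Proof.
move=> mh hC If; apply: (@le_L1 _ (fun x => C * `|f x|)).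
- by apply: measurable_funM => //; exact: L1_measurable.
- by move=> x; rewrite normrM mulrC ler_wpM2r.
- exact/L1Z/L1_norm.
Qed.

Lemma L1_norm_lty f : L1 mu f -> (\int[mu]_x `|f x|%:E < +oo)%E.
Proof. by move=> /integrableP[]. Qed.

Lemma L1_norm_fin f : L1 mu f ->
  (\int[mu]_x `|f x|%:E)%E = (\int[mu]_x `|f x|)%:E.
Proof.
move=> If; rewrite /Rintegral fineK//.
by apply: integrable_fin_num => //; exact: L1_norm.
Qed.

Lemma ae_Rintegral f g : measurable_fun setT f -> measurable_fun setT g ->
  {ae mu, forall x, f x = g x} -> \int[mu]_x f x = \int[mu]_x g x.
Proof.
move=> mf mg fg; congr fine; apply: ae_eq_integral => //.
- exact/measurable_EFinP.
- exact/measurable_EFinP.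
- by apply: filterS fg => x /= -> _.
Qed.

Lemma L1_sum {I : Type} (r : seq I) (F : I -> T -> R) :
  (forall i, L1 mu (F i)) -> L1 mu (fun x => \sum_(i <- r) F i x).
Proof.
move=> IF; elim: r => [|i r IHr].
  by under eq_fun do rewrite big_nil; exact: integrable0.
by under eq_fun do rewrite big_cons; exact: L1D.
Qed.

Lemma Rintegral_sum {I : Type} (r : seq I) (F : I -> T -> R) :
  (forall i, L1 mu (F i)) ->
  \int[mu]_x \sum_(i <- r) F i x = \sum_(i <- r) \int[mu]_x F i x.
Proof.
move=> IF; elim: r => [|i r IHr].
  rewrite big_nil; under eq_Rintegral do rewrite big_nil.
  by rewrite Rintegral_cst// mul0r.
rewrite big_cons -IHr -RintegralD//; [|exact: IF|exact: L1_sum].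
by apply: eq_Rintegral => x _; rewrite big_cons.
Qed.

Lemma ae_le_Rintegral f g : L1 mu f -> L1 mu g ->
  {ae mu, forall x, f x <= g x} -> \int[mu]_x f x <= \int[mu]_x g x.
Proof.
move=> If Ig fg; rewrite -subr_ge0 -RintegralB//.
have mgf := L1_measurable (L1B Ig If).
rewrite (@ae_Rintegral _ (fun x => `|g x - f x|)) ?Rintegral_ge0//.
  exact: measurableT_comp.
by apply: filterS fg => x fg; rewrite ger0_norm// subr_ge0.
Qed.

End L1_theory.

Lemma L1_bdd {d} {T : measurableType d} {R : realType} (P : probability T R)
    (f : T -> R) (C : R) :
  measurable_fun setT f -> (forall x, `|f x| <= C) -> L1 P f.
Proof.
move=> mf fC; apply: (@le_L1 _ _ _ _ _ (fun=> C)) => //.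
exact: finite_measure_integrable_cst.
Qed.

Section fubini_real.
Context {d1 d2} {X : measurableType d1} {Y : measurableType d2} {R : realType}.
Variables (m1 : {sigma_finite_measure set X -> \bar R})
          (m2 : {sigma_finite_measure set Y -> \bar R}).
Variable f : X * Y -> R.

Lemma L1_prodI : measurable_fun setT f ->
  (\int[m1]_x \int[m2]_y `|f (x, y)|%:E < +oo)%E -> L1 (m1 \x m2)%E f.
Proof.
by move=> mf foo; apply/(@integrable12ltyP _ _ _ _ _ m1 m2) => //;
  exact/measurable_EFinP.
Qed.

Lemma L1_prodE : L1 (m1 \x m2)%E f ->
  (\int[m1]_x \int[m2]_y `|f (x, y)|%:E < +oo)%E.
Proof.
move=> If; have /measurable_EFinP mf := L1_measurable If.
exact: (@integrable12ltyP _ _ _ _ _ m1 m2 _ mf).1 If.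
Qed.

Lemma L1_prodE2 : L1 (m1 \x m2)%E f ->
  (\int[m2]_y \int[m1]_x `|f (x, y)|%:E < +oo)%E.
Proof.
move=> If; have /measurable_EFinP mf := L1_measurable If.
exact: (@integrable21ltyP _ _ _ _ _ m1 m2 _ mf).1 If.
Qed.

Hypothesis If : L1 (m1 \x m2)%E f.

Let F_fin : {ae m1, forall x,
  fubini_F m2 (EFin \o f) x = (\int[m2]_y f (x, y))%:E}.
Proof.
have /integrable_ae := integrable_fubini_F If.
move=> /(_ measurableT); apply: filterS => x /(_ I) Fx.
by rewrite /Rintegral fineK.
Qed.

Lemma measurable_slice1 : measurable_fun setT (fun x => \int[m2]_y f (x, y)).
Proof. exact: (measurableT_comp (@fine_measurable R _ measurableT) (measurable_fubini_F If)). Qed.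

Lemma L1_slice1 : L1 m1 (fun x => \int[m2]_y f (x, y)).
Proof.
have IF := integrable_fubini_F If.
apply/integrableP; split; first exact/measurable_EFinP/measurable_slice1.
have /integrableP[mF] := IF; apply: le_lt_trans.
apply: ge0_le_integral => //.
- by do 2 apply: measurableT_comp => //; exact/measurable_slice1.
- by apply: measurableT_comp => //; exact: mF.
- move=> x _ /=; rewrite /Rintegral -/(fubini_F m2 (EFin \o f) x).
  by case: (fubini_F _ _ _) => [r||]//=; rewrite normr0 ?leey.
Qed.

Lemma Rfubini1 : \int[m1]_x \int[m2]_y f (x, y) = \int[(m1 \x m2)%E]_z f z.
Proof.
rewrite {1 3}/Rintegral -(integral12_prod_meas1 If); congr fine.
apply: ae_eq_integral => //; first exact/measurable_EFinP/measurable_slice1.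
  exact: (measurable_fubini_F If).
by apply: filterS F_fin => x -> _.
Qed.

Let G_fin : {ae m2, forall y,
  fubini_G m1 (EFin \o f) y = (\int[m1]_x f (x, y))%:E}.
Proof.
apply: filterS (ae_integrable2 If) => y /(integrable_fin_num measurableT) Gy.
by rewrite /Rintegral fineK.
Qed.

Lemma measurable_slice2 : measurable_fun setT (fun y => \int[m1]_x f (x, y)).
Proof. exact: (measurableT_comp (@fine_measurable R _ measurableT) (measurable_fubini_G If)). Qed.

Lemma Rfubini2 : \int[m2]_y \int[m1]_x f (x, y) = \int[(m1 \x m2)%E]_z f z.
Proof.
rewrite {1 3}/Rintegral -(integral21_prod_meas1 If); congr fine.
apply: ae_eq_integral => //; first exact/measurable_EFinP/measurable_slice2.
  exact: (measurable_fubini_G If).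
by apply: filterS G_fin => x -> _.
Qed.

End fubini_real.

Section sf_product.
Context {d1 d2} {X : measurableType d1} {Y : measurableType d2} {R : realType}.
Variables (m1 : {sigma_finite_measure set X -> \bar R})
          (m2 : {sigma_finite_measure set Y -> \bar R}).

(** Products of sigma-finite measures are bundled as sigma-finite measures, so
    that Fubini's theorem can be iterated on (time x space) x space. *)
Lemma sigma_finite_prod : sigma_finite setT (m1 \x m2)%E.
Proof.
by case: (lebesgue_integral_fubini.measure_function_Measure_isSigmaFinite__to__measure_function_isSigmaFinite
  m1 m2).
Qed.

Definition sf_product : {sigma_finite_measure set (X * Y)%type -> \bar R} :=
  HB.pack_for {sigma_finite_measure set (X * Y)%type -> \bar R} (m1 \x m2)%E
   (Measure_isSigmaFinite.Build _ _ _ (m1 \x m2)%E sigma_finite_prod).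
End sf_product.

(** * The energy function and a chain rule in time *)

Section japanese_bracket.
Context {R : realType}.
Implicit Types a b x : R.

(** The convex function whose integral in space serves as energy, and its
    bounded derivative, a smooth version of the sign. Boundedness is what
    allows testing an equation whose nonlinearity is merely in L^1. *)
Definition jap x : R := Num.sqrt (1 + x ^+ 2).
Definition beta x : R := x / jap x.

Lemma jap_arg_gt0 x : 0 < 1 + x ^+ 2.
Proof. by rewrite ltr_wpDr ?sqr_ge0. Qed.

Lemma jap_gt0 x : 0 < jap x.
Proof. by rewrite sqrtr_gt0 jap_arg_gt0. Qed.

Lemma sqr_jap x : jap x ^+ 2 = 1 + x ^+ 2.
Proof. by rewrite sqr_sqrtr// ltW// jap_arg_gt0. Qed.

Lemma jap0 : jap 0 = 1.
Proof. by rewrite /jap expr0n addr0 sqrtr1. Qed.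

Lemma normr_beta x : `|beta x| <= 1.
Proof.
rewrite /beta normrM normfV (gtr0_norm (jap_gt0 x)) ler_pdivrMr ?jap_gt0// mul1r.
rewrite -(ler_pXn2r (n := 2))// ?nnegrE ?normr_ge0 ?(ltW (jap_gt0 x))//.
by rewrite sqr_jap real_normK ?num_real// lerDr.
Qed.

(** Convexity: by Cauchy-Schwarz, 1 + a b <= jap a * jap b. *)
Lemma jap_subgradient a b : jap b - jap a <= beta b * (b - a).
Proof.
have jb := jap_gt0 b; have ja := jap_gt0 a.
have cs : 1 + a * b <= jap a * jap b.
  rewrite (le_trans (ler_norm _))//.
  rewrite -(ler_pXn2r (n := 2)) ?nnegrE ?normr_ge0 ?mulr_ge0 ?(ltW ja) ?(ltW jb)//.
  rewrite real_normK ?num_real// exprMn !sqr_jap.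
  rewrite -subr_ge0 (_ : _ - _ = (a - b) ^+ 2) ?sqr_ge0//; ring.
rewrite /beta mulrAC ler_pdivlMr// mulrBl -expr2 sqr_jap.
by lra.
Qed.

Lemma is_derive_beta x : is_derive x 1 (beta : R -> R) ((jap x ^+ 3)^-1).
Proof.
have j0 := jap_gt0 x; have a0 := jap_arg_gt0 x.
have d1 : is_derive x 1 (fun y : R => 1 + y ^+ 2) (2 * x).
  apply: is_derive_eq; rewrite add0r /GRing.scale/= ; ring.
have d2 : is_derive x 1 (jap : R -> R) (x / jap x).
  have := is_derive1_sqrt a0 => d3.
  have d4 := @is_derive1_comp _ Num.sqrt (fun y : R => 1 + y ^+ 2) x _ _ d3 d1.
  apply: (is_derive_eq d4); rewrite -/(jap x).
  by field; rewrite (gt_eqF j0).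
have j_neq0 : jap x != 0 by rewrite gt_eqF.
have d3 : is_derive x 1 (fun y : R => (jap y)^-1) (- jap x ^- 2 *: (x / jap x)).
  by apply: DeriveDef; [exact: derivableV|rewrite deriveV// derive_val].
have d4 := is_deriveM (is_derive_id x 1) d3.
apply: (is_derive_eq d4); rewrite /GRing.scale /=.
have := sqr_jap x; set j := jap x in j0 *; move=> sj.
have -> : x * (- j ^- 2 * (x / j)) + j^-1 * 1 = (j ^+ 2 - x ^+ 2) / j ^+ 3.
  by field; rewrite (gt_eqF j0).
by rewrite sj addrK mul1r.
Qed.

Lemma beta_continuous : continuous (beta : R -> R).
Proof.
move=> x; apply: differentiable_continuous; apply/derivable1_diffP.
by case: (is_derive_beta x).
Qed.

Lemma measurable_beta : measurable_fun setT (beta : R -> R).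
Proof. exact: continuous_measurable_fun beta_continuous. Qed.

Lemma beta_lipschitz a b : `|beta a - beta b| <= `|a - b|.
Proof.
wlog ab : a b / b < a.
  move=> H; case: (ltgtP a b) => [ab|/H//|->]; last by rewrite !subrr.
  by rewrite distrC [leRHS]distrC; exact: H.
have cf : {within `[b, a], continuous (beta : R -> R)}.
  exact: continuous_subspaceT beta_continuous.
have [c _ ->] := MVT ab (fun x _ => is_derive_beta x) cf.
rewrite normrM ler_piMl// gtr0_norm ?invr_gt0 ?exprn_gt0 ?jap_gt0//.
rewrite invf_le1 ?exprn_gt0 ?jap_gt0// exprn_ege1//.
rewrite -(ler_pXn2r (n := 2)) ?nnegrE ?(ltW (jap_gt0 _))// expr1n sqr_jap.
by rewrite lerDl sqr_ge0.
Qed.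

End japanese_bracket.

Section primitive.
Context {R : realType}.
Notation mu := (@lebesgue_measure R).
Variable h : R -> R.
Hypothesis Ih : L1 mu h.
Let V t := \int[mu]_(s in `[0, t]) h s.

Let IhS (A : set R) : measurable A -> mu.-integrable A (EFin \o h).
Proof. by move=> mA; apply: integrableS Ih. Qed.

Let InhS (A : set R) : measurable A -> mu.-integrable A (EFin \o (fun r => `|h r|)).
Proof. by move=> mA; apply/integrable_norm/IhS. Qed.

Let VB (s t : R) : 0 <= s -> s <= t -> V t - V s = \int[mu]_(r in `]s, t]) h r.
Proof.
move=> s0 st; rewrite /V Rintegral_itvB//.
exact: IhS.
Qed.

Lemma integrable_betaV (s t : R) : 0 <= s -> s <= t ->
  mu.-integrable `]s, t] (EFin \o (fun r => beta (V r) * h r)).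
Proof.
move=> s0 st.
have cV : {within `[0, t], continuous V}.
  by apply: parameterized_integral_continuous; [exact: le_trans st|exact: IhS].
have mV : measurable_fun `]s, t] (fun r => beta (V r)).
  apply: measurableT_comp; first exact: measurable_beta.
  apply: (@measurable_funS _ _ _ _ `[0, t]) => //.
    by apply: subset_itvScc; rewrite bnd_simp.
  exact: subspace_continuous_measurable_fun.
have bV : [bounded beta (V r) | r in `]s, t]].
  exists 1; split => // M M1 r _ /=.
  by rewrite (le_trans (normr_beta _))// ltW.
have mI : measurable `]s, t] by [].
have := integrableMr (mu := mu) mI mV bV (IhS mI).
by apply: eq_integrable.
Qed.

(** One step of the chain inequality: the defect is quadratic in the mass of
    |h|, because beta is 1-Lipschitz and V moves by at most that mass. *)
Let jap_step (s t : R) : 0 <= s -> s <= t ->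
  jap (V t) - jap (V s) <= \int[mu]_(r in `]s, t]) (beta (V r) * h r)
                           + (\int[mu]_(r in `]s, t]) `|h r|) ^+ 2.
Proof.
move=> s0 st; set m := \int[mu]_(r in `]s, t]) `|h r|.
have mI : measurable `]s, t] by [].
have t0 : 0 <= t by exact: le_trans st.
apply: (le_trans (jap_subgradient _ _)); rewrite VB// -lerBlDl.
rewrite -RintegralZl//; last exact: IhS.
have I1 : mu.-integrable `]s, t] (EFin \o (fun r => beta (V t) * h r)).
  by have := integrableZl (mu := mu) mI (beta (V t)) (IhS mI); apply: eq_integrable.
rewrite -RintegralB//; last exact: integrable_betaV.
rewrite (le_trans (ler_norm _))// (le_trans (le_normr_Rintegral _ _))//.
  by have := integrableB (mu := mu) mI I1 (integrable_betaV s0 st); apply: eq_integrable.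
rewrite expr2 -RintegralZl//; last exact: InhS.
apply: le_Rintegral => //.
- apply: integrable_norm.
  by have := integrableB (mu := mu) mI I1 (integrable_betaV s0 st); apply: eq_integrable.
- by have := integrableZl (mu := mu) mI m (InhS mI); apply: eq_integrable.
move=> r; rewrite /= in_itv/= => /andP[sr rt].
rewrite -mulrBl normrM ler_wpM2r// (le_trans (beta_lipschitz _ _))//.
rewrite VB//; last by rewrite (le_trans s0)// ltW.
rewrite (le_trans (le_normr_Rintegral _ _))//; first exact: IhS.
rewrite /m /Rintegral fine_le//.
- by apply: integrable_fin_num => //; exact: InhS.
- by apply: integrable_fin_num => //; exact: InhS.
- apply: ge0_subset_integral => //.
    by have /integrableP[] := InhS mI.
  by apply: subset_itvr; rewrite bnd_simp ltW.
Qed.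

Let split_itv (f : R -> R) (s t : R) : 0 <= s -> s <= t ->
  mu.-integrable `]0, t] (EFin \o f) ->
  \int[mu]_(r in `]0, t]) f r =
  \int[mu]_(r in `]0, s]) f r + \int[mu]_(r in `]s, t]) f r.
Proof.
by move=> s0 st If; rewrite -(@Rintegral_itvB _ _ _ _ s If)// addrC subrK.
Qed.

(** The chain rule for the absolutely continuous function V, as an inequality:
    convexity of jap compares the increments along a partition with the
    integrals over its cells, and the defects of jap_step add up to at most
    e times the mass of |h|, once every cell carries a mass at most e. *)
Lemma jap_primitive_le (t : R) : 0 <= t ->
  jap (V t) - 1 <= \int[mu]_(r in `]0, t]) (beta (V r) * h r).
Proof.
move=> t0; set m := \int[mu]_(r in `]0, t]) `|h r|.
have m0 : 0 <= m by exact: Rintegral_ge0.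
suff H (e : R) : 0 < e ->
    jap (V t) - 1 <= \int[mu]_(r in `]0, t]) (beta (V r) * h r) + e * m.
  apply/ler_addgt0Pr => e e0.
  have m1 : 0 < m + 1 by rewrite ltr_wpDl.
  have := H (e / (m + 1)) (divr_gt0 e0 m1); move/le_trans; apply.
  by rewrite lerD2l mulrAC ler_pdivrMr// ler_pM2l// lerDl.
move=> e0; have [d [d0 dP]] := integral_normr_continuous Ih e0.
have [N Nd] : exists N : nat, t / N.+1%:R < d.
  exists (Num.truncn (t / d)); rewrite ltr_pdivrMr ?ltr0n// mulrC -ltr_pdivrMr//.
  exact: truncnS_gt.
pose T (k : nat) : R := k%:R * (t / N.+1%:R).
have tN : 0 <= t / N.+1%:R by rewrite divr_ge0.
have T0 k : 0 <= T k by rewrite mulr_ge0.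
have TS k : T k <= T k.+1 by rewrite ler_wpM2r// ler_nat.
suff H k : jap (V (T k)) - 1 <=
    \int[mu]_(r in `]0, T k]) (beta (V r) * h r)
    + e * \int[mu]_(r in `]0, T k]) `|h r|.
  by have := H N.+1; rewrite /T mulrCA divff ?mulr1 ?pnatr_eq0.
elim: k => [|k IHk].
  rewrite /T mul0r !set_itv_ge ?bnd_simp ?ltxx// !Rintegral_set0.
  by rewrite /V set_itv1 Rintegral_set1 jap0 subrr mulr0 addr0.
rewrite (split_itv (T0 k) (TS k)); last exact: integrable_betaV.
rewrite (split_itv (T0 k) (TS k) (InhS _))//.
have := jap_step (T0 k) (TS k).
have mk : \int[mu]_(r in `]T k, T k.+1]) `|h r| < e.
  apply: dP => //.
  rewrite [X in (X < _)%E](lebesgue_measure_itv `]T k, T k.+1]).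
  rewrite /=; case: ifPn => _.
    by rewrite -EFinD lte_fin /T -mulrBl -natrB// subSnn mul1r.
  by rewrite lte_fin.
have mk0 : 0 <= \int[mu]_(r in `]T k, T k.+1]) `|h r| by exact: Rintegral_ge0.
move: IHk mk mk0; set x1 := Rintegral _ _ _; set x2 := Rintegral _ _ _.
set x3 := Rintegral _ _ _; set x4 := Rintegral _ _ _.
nra.
Qed.

End primitive.

(** * Approximate identities *)

Definition kint {d} {X : measurableType d} {R : realType} (P : probability X R)
    (k : X -> X -> R) (v : X -> R) (x : X) : R :=
  \int[P]_y (v y * k x y).

(** A sequence of Markov kernels, with bounded densities, whose integral
    operators converge strongly to the identity of L^1. *)
Record approx_id {d} {X : measurableType d} {R : realType} (P : probability X R)
    (k : nat -> X -> X -> R) : Prop := ApproxId {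
  ai_measurable : forall n, measurable_fun setT (fun z : X * X => k n z.1 z.2) ;
  ai_ge0 : forall n x y, 0 <= k n x y ;
  ai_bounded : forall n, exists C, forall x y, k n x y <= C ;
  ai_mass : forall n y, (\int[P]_x (k n x y)%:E = 1)%E ;
  ai_cvg : forall v, L1 P v ->
    (\int[P]_x `|kint P (k n) v x - v x|%:E)%E @[n --> \oo] --> 0%E }.

Section one_kernel.
Context {d} {X : measurableType d} {R : realType} (P : probability X R).
Variables (k : X -> X -> R) (C : R).
Hypothesis mk : measurable_fun setT (fun z : X * X => k z.1 z.2).
Hypothesis kC : forall x y, `|k x y| <= C.

Lemma measurable_kernelr x : measurable_fun setT (k x).
Proof. exact: (measurableT_comp mk (pair1_measurable x)). Qed.

Lemma measurable_kernell y : measurable_fun setT (k^~ y).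
Proof. exact: (measurableT_comp mk (pair2_measurable y)). Qed.

Lemma L1_kernel v x : L1 P v -> L1 P (fun y => v y * k x y).
Proof. exact: (L1_bddM (measurable_kernelr x) (kC x)). Qed.

Lemma kintB v w x : L1 P v -> L1 P w ->
  kint P k (fun y => v y - w y) x = kint P k v x - kint P k w x.
Proof.
move=> Iv Iw; rewrite /kint -RintegralB//; try exact: L1_kernel.
by apply: eq_Rintegral => y _; rewrite mulrBl.
Qed.

Lemma L1_kint v : L1 P v -> L1 P (kint P k v).
Proof.
move=> Iv; have mv := L1_measurable Iv.
have Iv2 : L1 (P \x P)%E (fun z : X * X => v z.2 * k z.1 z.2).
  apply: (L1_bddM mk) => //.
  apply: (@L1_prodI _ _ _ _ _ P P); first exact: measurableT_comp.
  rewrite /= integral_cst// [X in (_ * X)%E]probability_setT mule1.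
  exact: L1_norm_lty.
exact: (L1_slice1 Iv2).
Qed.

Section slices.
Context {d'} {S : measurableType d'}.
Variable m : {sigma_finite_measure set S -> \bar R}.
Variable g : S * X -> R.
Hypothesis Ig : L1 (m \x P)%E g.

(** Tonelli, P having mass one. *)
Lemma L1_lift : L1 ((m \x P) \x P)%E (fun q : (S * X) * X => g (q.1.1, q.2)).
Proof.
have mg := L1_measurable Ig.
have mgl : measurable_fun setT (fun q : (S * X) * X => g (q.1.1, q.2)).
  apply: measurableT_comp => //.
  apply: measurable_fun_pair => //.
  exact: (measurableT_comp measurable_fst measurable_fst).
apply: (@L1_prodI _ _ _ _ _ (sf_product m P) P) => //.
have mA : measurable_fun setT (fun s => \int[P]_y `|g (s, y)|%:E)%E.
  apply: (measurable_fun_fubini_tonelli_F (fun z => `|g z|%:E)%E) => //.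
  by apply/measurable_EFinP; exact: measurableT_comp.
rewrite (@fubini_tonelli1 _ _ _ _ _ m P
  (fun z : S * X => \int[P]_y `|g (z.1, y)|%:E)%E)/=.
- have := L1_prodE Ig; apply: le_lt_trans; rewrite /fubini_F /=.
  rewrite le_eqVlt; apply/orP; left; apply/eqP.
  apply: eq_integral => s _; rewrite integral_cst//.
  by rewrite [X in (_ * X)%E]probability_setT mule1.
- exact: (measurableT_comp mA measurable_fst).
- by move=> z; exact: integral_ge0.
Qed.

Lemma L1_kernel_lift :
  L1 ((m \x P) \x P)%E (fun q : (S * X) * X => g (q.1.1, q.2) * k q.1.2 q.2).
Proof.
apply: (@L1_bddM _ _ _ _ C (fun q : (S * X) * X => k q.1.2 q.2)) => //.
- have mp : measurable_fun setT (fun q : (S * X) * X => (q.1.2, q.2)).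
    apply: measurable_fun_pair => //.
    exact: (measurableT_comp measurable_snd measurable_fst).
  exact: (measurableT_comp mk mp).
- exact: L1_lift.
Qed.

Lemma L1_kint_slices :
  L1 (m \x P)%E (fun z => kint P k (fun y => g (z.1, y)) z.2).
Proof. exact: (@L1_slice1 _ _ _ _ _ (sf_product m P) P _ L1_kernel_lift). Qed.

End slices.

Hypothesis k0 : forall x y, 0 <= k x y.
Hypothesis k1 : forall y, (\int[P]_x (k x y)%:E = 1)%E.

(** Tonelli again: every y is spread by k into a function of x of mass one. *)
Lemma kint_contraction v : L1 P v ->
  (\int[P]_x `|kint P k v x|%:E <= \int[P]_y `|v y|%:E)%E.
Proof.
move=> Iv; have mv := L1_measurable Iv.
have mvk : measurable_fun setT (fun z : X * X => (`|v z.2| * k z.1 z.2)%:E).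
  apply/measurable_EFinP; apply: measurable_funM => //.
  by apply: measurableT_comp => //; exact: measurableT_comp.
apply: (@le_trans _ _ (\int[P]_x \int[P]_y (`|v y| * k x y)%:E)%E).
  apply: ge0_le_integral => //.
  - apply/measurable_EFinP; apply: measurableT_comp => //.
    exact: L1_measurable (L1_kint Iv).
  - apply: (measurable_fun_fubini_tonelli_F (m2 := P) _ mvk) => z.
    by rewrite lee_fin mulr_ge0.
  - move=> x _.
    rewrite (le_trans _ (_ : (\int[P]_y `|(v y * k x y)|)%:E <= _)%E)//.
      by rewrite lee_fin le_normr_Rintegral//; exact: L1_kernel.
    rewrite -L1_norm_fin; last exact: L1_kernel.
    rewrite le_eqVlt; apply/orP; left; apply/eqP; apply: eq_integral => y _.
    by rewrite normrM (ger0_norm (k0 _ _)).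
rewrite (fubini_tonelli (fun z : X * X => (`|v z.2| * k z.1 z.2)%:E))//=.
rewrite le_eqVlt; apply/orP; left; apply/eqP; apply: eq_integral => y _.
under eq_integral do rewrite EFinM.
rewrite ge0_integralZl//.
- by rewrite k1 mule1.
- exact/measurable_EFinP/measurable_kernell.
- by move=> x _; rewrite lee_fin.
by move=> z; rewrite lee_fin mulr_ge0.
Qed.

End one_kernel.

Section approx_id_theory.
Context {d} {X : measurableType d} {R : realType} (P : probability X R).
Variable k : nat -> X -> X -> R.
Hypothesis kP : approx_id P k.

Lemma ai_norm_bounded n : exists C, forall x y, `|k n x y| <= C.
Proof.
have [C kC] := ai_bounded kP n; exists C => x y.
by rewrite ger0_norm ?kC//; exact: (ai_ge0 kP).
Qed.

(** Strong convergence on the fibres of a product integrates to strong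
    convergence on the product, by dominated convergence: on almost every
    fibre the error is at most twice the L^1 norm of the fibre. *)
Lemma ai_cvg_slices {d'} {S : measurableType d'}
    (m : {sigma_finite_measure set S -> \bar R}) (g : S * X -> R) :
  L1 (m \x P)%E g ->
  (\int[m]_s \int[P]_x
     `|kint P (k n) (fun y => g (s, y)) x - g (s, x)|%:E)%E
  @[n --> \oo] --> 0%E.
Proof.
move=> Ig; have mg := L1_measurable Ig.
pose err n (z : S * X) := kint P (k n) (fun y => g (z.1, y)) z.2 - g z.
have merr n : measurable_fun setT (err n).
  have [C kC] := ai_norm_bounded n.
  apply: measurable_funB => //.
  exact: L1_measurable (L1_kint_slices (ai_measurable kP n) kC Ig).
have mnerr n : measurable_fun setT (fun z => `|err n z|%:E).
  by apply/measurable_EFinP; exact: measurableT_comp.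
pose f n s := (\int[P]_x `|err n (s, x)|%:E)%E.
have mf n : measurable_fun setT (f n).
  by apply: (measurable_fun_fubini_tonelli_F (m2 := P) _ (mnerr n)) => z.
have aeL1 : {ae m, forall s, L1 P (fun x => g (s, x))} := ae_integrable1 Ig.
pose G s := (\int[P]_x `|g (s, x)|%:E + \int[P]_x `|g (s, x)|%:E)%E.
have IG0 : m.-integrable setT (fun s => \int[P]_x `|g (s, x)|%:E)%E.
  apply/integrableP; split.
    apply: (measurable_fun_fubini_tonelli_F (m2 := P) (fun z => `|g z|%:E)%E) => //.
    by apply/measurable_EFinP; exact: measurableT_comp.
  under eq_integral do rewrite gee0_abs ?integral_ge0//.
  exact: L1_prodE Ig.
have IG : m.-integrable setT G by exact: integrableD.
have f0 : {ae m, forall s, setT s -> f n s @[n --> \oo] --> 0%E}.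
  apply: filterS aeL1 => s Igs _.
  rewrite /f /err /=.
  exact: (ai_cvg kP Igs).
have fG : {ae m, forall s n, setT s -> (`|f n s| <= G s)%E}.
  apply: filterS aeL1 => s Igs n _.
  have [C kC] := ai_norm_bounded n.
  have mgs := L1_measurable Igs.
  have merrs : measurable_fun setT (fun x => err n (s, x)).
    exact: (measurableT_comp (merr n) (pair1_measurable s)).
  have mks : measurable_fun setT (kint P (k n) (fun y => g (s, y))).
    have -> : kint P (k n) (fun y => g (s, y)) =
        (fun x => err n (s, x) + g (s, x)).
      by apply/funext => x; rewrite /err subrK.
    exact: measurable_funD.
  rewrite gee0_abs ?integral_ge0//.
  apply: (@le_trans _ _ (\int[P]_x
     (`|kint P (k n) (fun y => g (s, y)) x|%:E + `|g (s, x)|%:E))%E).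
    apply: ge0_le_integral => //.
    + by apply/measurable_EFinP; exact: measurableT_comp.
    + by apply/measurable_EFinP; apply: measurable_funD; exact: measurableT_comp.
    + by move=> x _; rewrite -EFinD lee_fin ler_normB.
  rewrite ge0_integralD//; do ?by apply/measurable_EFinP; exact: measurableT_comp.
  rewrite leeD2r//.
  apply: (kint_contraction (ai_measurable kP n) kC) => //.
    exact: (ai_ge0 kP).
  exact: (ai_mass kP).
have [_ _] := dominated_convergence measurableT mf (measurable_cst _) f0 IG fG.
by rewrite [X in _ --> X]integral0.
Qed.

End approx_id_theory.

Section tensor_product.
Context {d1 d2} {X : measurableType d1} {Y : measurableType d2} {R : realType}.
Variables (P : probability X R) (Q : probability Y R).

Section one_kernel.
Variables (k : X -> X -> R) (l : Y -> Y -> R) (C D : R).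
Hypothesis mk : measurable_fun setT (fun z : X * X => k z.1 z.2).
Hypothesis ml : measurable_fun setT (fun z : Y * Y => l z.1 z.2).
Hypothesis kC : forall x y, `|k x y| <= C.
Hypothesis lD : forall x y, `|l x y| <= D.

Lemma measurable_tensor : measurable_fun setT
  (fun z : (X * Y) * (X * Y) => k z.1.1 z.2.1 * l z.1.2 z.2.2).
Proof.
apply: measurable_funM.
- have mp : measurable_fun setT (fun q : (X * Y) * (X * Y) => (q.1.1, q.2.1)).
    apply: measurable_fun_pair.
      exact: (measurableT_comp measurable_fst measurable_fst).
    exact: (measurableT_comp measurable_fst measurable_snd).
  exact: (measurableT_comp mk mp).
- have mp : measurable_fun setT (fun q : (X * Y) * (X * Y) => (q.1.2, q.2.2)).
    apply: measurable_fun_pair.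
      exact: (measurableT_comp measurable_snd measurable_fst).
    exact: (measurableT_comp measurable_snd measurable_snd).
  exact: (measurableT_comp ml mp).
Qed.

Lemma tensor_bounded (z w : X * Y) : `|k z.1 w.1 * l z.2 w.2| <= C * D.
Proof. by rewrite normrM ler_pM. Qed.

(** The two factors act successively; the inner integral is only defined for
    almost every value of the first variable. *)
Lemma kint_tensor v (z : X * Y) : L1 (P \x Q)%E v ->
  kint [the probability _ R of (P \x Q)%E]
    (fun z w => k z.1 w.1 * l z.2 w.2) v z =
  kint P k (fun x => kint Q l (fun y => v (x, y)) z.2) z.1.
Proof.
move=> Iv; case: z => x y /=; rewrite /kint /=.
have mkl : measurable_fun setT (fun w : X * Y => k x w.1 * l y w.2).
  exact: (measurableT_comp measurable_tensor (pair1_measurable (x, y))).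
have Ivkl : L1 (P \x Q)%E (fun w => v w * (k x w.1 * l y w.2)).
  by apply: (L1_bddM mkl _ Iv) => w; exact: (tensor_bounded (x, y)).
have Ivl : L1 (P \x Q)%E (fun w => v w * l y w.2).
  apply: (L1_bddM _ _ Iv) => [|w]; last exact: lD.
  exact: (measurableT_comp (measurable_kernelr ml y) measurable_snd).
rewrite -(Rfubini1 Ivkl); apply: ae_Rintegral.
- exact: measurable_slice1 Ivkl.
- apply: measurable_funM; last exact: measurable_kernelr.
  exact: measurable_slice1 Ivl.
have aeL1 : {ae P, forall s, L1 Q (fun y => v (s, y))} := ae_integrable1 Iv.
apply: filterS aeL1 => s Is /=.
rewrite -RintegralZr//; last exact: (L1_kernel ml lD).
by apply: eq_Rintegral => t _; rewrite mulrCA mulrC.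
Qed.

End one_kernel.

Variables (k : nat -> X -> X -> R) (l : nat -> Y -> Y -> R).
Hypotheses (kP : approx_id P k) (lP : approx_id Q l).

Let kl n (z w : X * Y) : R := k n z.1 w.1 * l n z.2 w.2.

Let PQ := [the probability _ R of (P \x Q)%E].

(** With k and l acting on one variable each,
    (k (x) l) v - v = k (l v - v) + (k v - v): the first term is controlled by
    contraction, and both differences tend to zero fibre by fibre. *)
Let tensor_cvg v : L1 (P \x Q)%E v ->
  (\int[PQ]_x `|kint PQ (kl n) v x - v x|%:E)%E @[n --> \oo] --> 0%E.
Proof.
move=> Iv; have mv := L1_measurable Iv.
pose v' (w : Y * X) := v (w.2, w.1).
have mswap : measurable_fun setT (fun w : Y * X => (w.2, w.1)).
  exact: measurable_fun_pair.
have Iv' : L1 (Q \x P)%E v'.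
  apply: (@L1_prodI _ _ _ _ _ Q P); first exact: (measurableT_comp mv mswap).
  exact: L1_prodE2 Iv.
have c1 := ai_cvg_slices lP Iv.
have c2 := ai_cvg_slices kP Iv'.
apply: (squeeze_cvge _ (cvg_cst 0%E)); last first.
  rewrite -[X in _ --> X]adde0; exact: (cvgeD _ c1 c2).
apply: nearW => n; rewrite integral_ge0//=.
have [C kC] := ai_norm_bounded kP n.
have [D lD] := ai_norm_bounded lP n.
have mk := ai_measurable kP n.
have ml := ai_measurable lP n.
pose vl (z : X * Y) := kint Q (l n) (fun y => v (z.1, y)) z.2.
have Ivl : L1 (P \x Q)%E vl := L1_kint_slices ml lD Iv.
pose B (w : Y * X) := kint P (k n) (fun x => v (x, w.1)) w.2 - v (w.2, w.1).
have IB : L1 (Q \x P)%E B.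
  by apply: L1B => //; exact: (L1_kint_slices mk kC Iv').
pose A (z : X * Y) := vl z - v z.
have IA : L1 (P \x Q)%E A by exact: L1B.
pose err (z : X * Y) := kint PQ (kl n) v z - v z.
have Ierr : L1 (P \x Q)%E err.
  apply: L1B => //.
  have -> : kint PQ (kl n) v = (fun z => kint P (k n) (fun x => vl (x, z.2)) z.1).
    by apply/funext => z; exact: (kint_tensor mk ml kC lD).
  pose vl' (w : Y * X) := vl (w.2, w.1).
  have Ivl' : L1 (Q \x P)%E vl'.
    apply: (@L1_prodI _ _ _ _ _ Q P); last exact: L1_prodE2 Ivl.
    exact: (measurableT_comp (L1_measurable Ivl) mswap).
  have Ik := L1_kint_slices mk kC Ivl'.
  have mswap' : measurable_fun setT (fun w : X * Y => (w.2, w.1)).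
    exact: measurable_fun_pair.
  apply: (@L1_prodI _ _ _ _ _ P Q); last exact: L1_prodE2 Ik.
  exact: (measurableT_comp (L1_measurable Ik) mswap').
have mnorm d d' (S : measurableType d) (S' : measurableType d') (f : S * S' -> R) :
    measurable_fun setT f -> measurable_fun setT (fun z => `|f z|%:E).
  by move=> mf; apply/measurable_EFinP; exact: measurableT_comp.
have mnerr := mnorm _ _ _ _ _ (L1_measurable Ierr).
have mnA := mnorm _ _ _ _ _ (L1_measurable IA).
have mnB := mnorm _ _ _ _ _ (L1_measurable IB).
have tA : (\int[P]_x \int[Q]_y `|A (x, y)|%:E =
    \int[Q]_y \int[P]_x `|A (x, y)|%:E)%E.
  exact: (@fubini_tonelli _ _ _ _ _ P Q _ mnA).
suff H : (\int[PQ]_x `|err x|%:E <= \int[Q]_y \int[P]_x `|A (x, y)|%:E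
    + \int[Q]_y \int[P]_x `|B (y, x)|%:E)%E by rewrite -tA in H; exact: H.
rewrite (@fubini_tonelli2 _ _ _ _ _ P Q _ mnerr) => [|z]; last by [].
have mIA : measurable_fun setT (fun y => \int[P]_x `|A (x, y)|%:E)%E.
  by apply: (measurable_fun_fubini_tonelli_G (m1 := P) _ mnA).
have mIB : measurable_fun setT (fun y => \int[P]_x `|B (y, x)|%:E)%E.
  by apply: (measurable_fun_fubini_tonelli_F (m2 := P) _ mnB).
rewrite -ge0_integralD//; try by move=> y _; exact: integral_ge0.
apply: ae_ge0_le_integral => //.
- by move=> y _; exact: integral_ge0.
- by apply: (measurable_fun_fubini_tonelli_G (m1 := P) _ mnerr).
- by move=> y _; rewrite adde_ge0// integral_ge0.
- exact: emeasurable_funD.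
have ae1 : {ae Q, forall y, L1 P (fun x => v (x, y))} := ae_integrable2 Iv.
have ae2 : {ae Q, forall y, L1 P (fun x => vl (x, y))} := ae_integrable2 Ivl.
apply: filterS2 ae1 ae2 => y Iv1 Iv2 _.
have IAy : L1 P (fun x => A (x, y)) by exact: L1B.
apply: (@le_trans _ _
  (\int[P]_x (`|kint P (k n) (fun x => A (x, y)) x|%:E + `|B (y, x)|%:E))%E).
  apply: ge0_le_integral => //.
  - exact: (measurableT_comp mnerr (pair2_measurable y)).
  - apply/measurable_EFinP; apply: measurable_funD; last first.
      apply: measurableT_comp => //.
      exact: (measurableT_comp (L1_measurable IB) (pair1_measurable y)).
    by apply: measurableT_comp => //; exact: L1_measurable (L1_kint mk kC IAy).
  - move=> x _; rewrite -EFinD lee_fin /err (kint_tensor mk ml kC lD)//=.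
    rewrite /A /B (kintB mk kC)//=.
    rewrite (le_trans _ (ler_normD _ _))// addrA subrK//.
rewrite ge0_integralD//.
- rewrite leeD2r//; apply: (kint_contraction mk kC) => //.
    exact: (ai_ge0 kP).
  exact: (ai_mass kP).
- apply/measurable_EFinP; apply: measurableT_comp => //.
  exact: L1_measurable (L1_kint mk kC IAy).
- exact: (measurableT_comp mnB (pair1_measurable y)).
Qed.

Lemma approx_id_tensor : approx_id PQ kl.
Proof.
split.
- by move=> n; apply: measurable_tensor; [exact: (ai_measurable kP)|exact: (ai_measurable lP)].
- by move=> n x y; rewrite mulr_ge0//; [exact: (ai_ge0 kP)|exact: (ai_ge0 lP)].
- move=> n; have [C kC] := ai_norm_bounded kP n; have [D lD] := ai_norm_bounded lP n.
  by exists (C * D) => z w; rewrite (le_trans (ler_norm _))// (tensor_bounded kC lD).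
- move=> n w.
  have m1 := measurable_kernell (ai_measurable kP n) w.1.
  have m2 := measurable_kernell (ai_measurable lP n) w.2.
  have m : measurable_fun setT (fun z : X * Y => (kl n z w)%:E).
    apply/measurable_EFinP; apply: measurable_funM.
      exact: (measurableT_comp m1 measurable_fst).
    exact: (measurableT_comp m2 measurable_snd).
  rewrite (@fubini_tonelli1 _ _ _ _ _ P Q _ m) => [|z]; last first.
    by rewrite lee_fin mulr_ge0//; [exact: (ai_ge0 kP)|exact: (ai_ge0 lP)].
  rewrite /fubini_F /kl /=.
  rewrite -(ai_mass kP n w.1); apply: eq_integral => x _.
  under eq_integral do rewrite EFinM.
  rewrite ge0_integralZl//.
  + by rewrite (ai_mass lP) mule1.
  + exact/measurable_EFinP.
  + by move=> y _; rewrite lee_fin (ai_ge0 lP).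
  + by rewrite lee_fin (ai_ge0 kP).
- exact: tensor_cvg.
Qed.

End tensor_product.

(** Transport along a surjection phi: L^1 of the image measure embeds
    isometrically by composition with phi, and the integral operator of l then
    becomes that of k. *)
Lemma approx_id_image {d1 d2} {X : measurableType d1} {Y : measurableType d2}
    {R : realType} (P : probability X R) (phi : {mfun X >-> Y})
    (k : nat -> X -> X -> R) (l : nat -> Y -> Y -> R) :
  (forall y, exists x, phi x = y) ->
  (forall n, measurable_fun setT (fun z : Y * Y => l n z.1 z.2)) ->
  (forall n x y, l n (phi x) (phi y) = k n x y) ->
  approx_id P k -> approx_id [the probability _ R of distribution P phi] l.
Proof.
move=> surj ml lk kP.
have L1phi v : L1 (distribution P phi) v -> L1 P (v \o phi).
  move=> Iv; have mv := L1_measurable Iv.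
  apply/integrableP; split; first by apply/measurable_EFinP; exact: measurableT_comp.
  have /integrableP[_] := Iv; rewrite ge0_integral_distribution//.
  by apply: measurableT_comp => //; exact/measurable_EFinP.
have kintE n v x : L1 (distribution P phi) v ->
    kint [the probability _ R of distribution P phi] (l n) v (phi x) =
    kint P (k n) (v \o phi) x.
  move=> Iv; have [C kC] := ai_norm_bounded kP n.
  rewrite /kint /Rintegral; congr fine.
  have mvl : measurable_fun setT (fun y => (v y * l n (phi x) y)%:E).
    apply/measurable_EFinP; apply: measurable_funM; first exact: L1_measurable Iv.
    exact: measurable_kernelr (ml n) (phi x).
  rewrite [LHS](@integral_pushforward _ _ _ _ _ phi _ P setT _ mvl)//.
    by apply: eq_integral => y _ /=; rewrite lk.
  rewrite preimage_setT.
  have := L1_kernel (ai_measurable kP n) kC x (L1phi _ Iv).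
  by apply: eq_integrable => // y _ /=; rewrite lk.
split=> //.
- move=> n x' y'; have [x <-] := surj x'; have [y <-] := surj y'.
  by rewrite lk (ai_ge0 kP).
- move=> n; have [C kC] := ai_bounded kP n; exists C => x' y'.
  by have [x <-] := surj x'; have [y <-] := surj y'; rewrite lk.
- move=> n y'; have [y <-] := surj y'.
  rewrite ge0_integral_distribution//.
  + by rewrite -(ai_mass kP n y); apply: eq_integral => x _ /=; rewrite lk.
  + exact/measurable_EFinP/(measurable_kernell (ml n)).
  + by move=> x'; have [x <-] := surj x'; rewrite lee_fin lk (ai_ge0 kP).
- move=> v Iv; have := ai_cvg kP (L1phi _ Iv).
  apply: cvg_trans; apply: near_eq_cvg; apply: nearW => n.
  have [C kC] := ai_norm_bounded kP n.
  have lC y y' : `|l n y y'| <= C.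
    by have [x <-] := surj y; have [x' <-] := surj y'; rewrite lk.
  rewrite ge0_integral_distribution//.
  + by apply: eq_integral => x _; rewrite /= kintE.
  + apply/measurable_EFinP; apply: measurableT_comp => //.
    apply: measurable_funB; last exact: L1_measurable Iv.
    exact: L1_measurable (L1_kint (ml n) lC Iv).
Qed.

(** * The Fejer kernel on the circle *)

Section uniform_integral.
Context {R : realType}.
Notation U := (uniform_prob (@ltr01 R)).
Notation mu := (@lebesgue_measure R).

Lemma Rintegral_uniform (f : R -> R) : measurable_fun setT f ->
  \int[U]_x f x = \int[mu]_(x in `[0, 1]) f x.
Proof.
move=> mf; have mEf : measurable_fun setT (EFin \o f) by exact/measurable_EFinP.
rewrite /Rintegral; congr fine; rewrite integralE [RHS]integralE.
by congr (_ - _)%E; rewrite integral_uniform ?subr0 ?invr1 ?mul1e//;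
  [exact: measurable_funepos|exact: measurable_funeneg].
Qed.

Lemma Rintegral_uniform_derive (F f : R -> R) :
  (forall x : R, is_derive x (1 : R) F (f x)) -> continuous f ->
  \int[U]_x f x = F 1 - F 0.
Proof.
move=> dF cf; rewrite Rintegral_uniform; last exact: continuous_measurable_fun.
have cF x : {for x, continuous F}.
  by apply: differentiable_continuous; apply/derivable1_diffP; case: (dF x).
rewrite /Rintegral (@continuous_FTC2 _ f F)//.
- exact: continuous_subspaceT.
- split; first by move=> x _; case: (dF x).
  + exact: cvg_at_right_filter (cF 0).
  + exact: cvg_at_left_filter (cF 1).
- by move=> x _; rewrite derive1E; case: (dF x).
Qed.

Lemma ae_uniform_itv : {ae U, forall x : measurableTypeR R, 0 < x < 1}.
Proof.
exists (~` `]0, 1[); split; first exact: measurableC.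
  rewrite -[X in _ X = _](@setIT) -integral_indic//; last exact: measurableC.
  rewrite integral_uniform//; last first.
    by apply/measurable_EFinP; apply: measurable_indic; exact: measurableC.
  rewrite subr0 invr1 mul1e integral_indic//; last exact: measurableC.
  rewrite setIC -setDE.
  have -> : [set` `[(0:R), 1]] `\` [set` `](0:R), 1[] = [set 0; 1].
    rewrite eqEsubset; split => [x [/=]|x [->|->]/=]; rewrite !in_itv/= ?lexx ?ltxx.
    - move=> /andP[x0 x1] /negP; rewrite negb_and -!leNgt => /orP[x0'|x1'].
        by left; apply/eqP; rewrite eq_le x0 x0'.
      by right; apply/eqP; rewrite eq_le x1 x1'.
    - by rewrite ler01.
    - by rewrite ler01 andbF.
  rewrite measureU0//; exact: lebesgue_measure_set1.
by apply: subsetC => x; rewrite /= in_itv.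
Qed.

End uniform_integral.

Section fejer.
Context {R : realType}.
Implicit Types (N j p q : nat) (x y t : R).

Definition freq p q : R := (p%:R - q%:R) * (pi *+ 2).

(** The j-th derivative of the Fejer kernel on the circle R/Z, which is
    (N+1)^-1 times the sum over p, q <= N of cos (2 pi (p - q) t): a derivative
    of the cosine shifts its phase by pi / 2. *)
Definition fejerd N j t : R :=
  N.+1%:R^-1 * \sum_(p < N.+1) \sum_(q < N.+1)
    freq p q ^+ j * cos (freq p q * t + j%:R * (pi / 2)).

Lemma cos_freq p q x : cos (x + freq p q) = cos x.
Proof.
rewrite /freq mulrBl addrA !mulr_natl.
rewrite -(periodicn (@cosD2pi R) q (_ - _)) subrK.
exact: periodicn (@cosD2pi R) p x.
Qed.

Lemma sin_freq p q x : sin (x + freq p q) = sin x.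
Proof. by rewrite -!cosBpihalf addrAC cos_freq. Qed.

Lemma fejerd_periodic N j t : fejerd N j (t + 1) = fejerd N j t.
Proof.
congr (_ * _); apply: eq_bigr => p _; apply: eq_bigr => q _; congr (_ * _).
by rewrite mulrDr mulr1 addrAC cos_freq.
Qed.

Lemma fejerd_bounded N j : exists C, forall t, `|fejerd N j t| <= C.
Proof.
exists (N.+1%:R^-1 * \sum_(p < N.+1) \sum_(q < N.+1) `|freq p q ^+ j|) => t.
rewrite /fejerd normrM ger0_norm ?invr_ge0// ler_wpM2l ?invr_ge0//.
rewrite (le_trans (ler_norm_sum _ _ _))// ler_sum// => p _.
rewrite (le_trans (ler_norm_sum _ _ _))// ler_sum// => q _.
by rewrite normrM ler_piMr// cos_max.
Qed.

Lemma is_derive_fejerd N j t : is_derive t 1 (fejerd N j) (fejerd N j.+1 t).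
Proof.
pose f p q x := freq p q ^+ j * cos (freq p q * x + j%:R * (pi / 2)).
have df p q : is_derive t 1 (f p q)
    (freq p q ^+ j.+1 * cos (freq p q * t + j.+1%:R * (pi / 2))).
  have -> : freq p q * t + j.+1%:R * (pi / 2) =
      freq p q * t + j%:R * (pi / 2) + pi / 2.
    by rewrite -natr1 mulrDl mul1r addrA.
  rewrite cosDpihalf exprSr; apply: is_derive_eq.
  rewrite /GRing.scale/=; ring.
have ds p : is_derive t 1 (fun x => \sum_(q < N.+1) f p q x)
    (\sum_(q < N.+1) freq p q ^+ j.+1 * cos (freq p q * t + j.+1%:R * (pi / 2))).
  have -> : (fun x => \sum_(q < N.+1) f p q x) = \sum_(q < N.+1) f p q.
    by apply/funext => x; rewrite fct_sumE.
  exact: is_derive_sum.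
have dss : is_derive t 1 (fun x => \sum_(p < N.+1) \sum_(q < N.+1) f p q x)
    (\sum_(p < N.+1) \sum_(q < N.+1)
       freq p q ^+ j.+1 * cos (freq p q * t + j.+1%:R * (pi / 2))).
  have -> : (fun x => \sum_(p < N.+1) \sum_(q < N.+1) f p q x) =
      \sum_(p < N.+1) (fun x => \sum_(q < N.+1) f p q x).
    by apply/funext => x; rewrite fct_sumE.
  exact: is_derive_sum.
exact: is_deriveZ.
Qed.

Lemma fejerd_continuous N j : continuous (fejerd N j).
Proof.
move=> t; apply: differentiable_continuous; apply/derivable1_diffP.
by case: (is_derive_fejerd N j t).
Qed.

Lemma measurable_fejerd N j : measurable_fun setT (fejerd N j).
Proof. by apply: continuous_measurable_fun; exact: fejerd_continuous. Qed.

Let cs N t : R := \sum_(p < N) cos (p%:R * (pi *+ 2 * t)).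
Let sn N t : R := \sum_(p < N) sin (p%:R * (pi *+ 2 * t)).

(** The Fejer kernel is |1 + z + ... + z^N|^2 / (N + 1) for z = exp(2 pi i t). *)
Let fejerE N t : fejerd N 0 t = N.+1%:R^-1 * (cs N.+1 t ^+ 2 + sn N.+1 t ^+ 2).
Proof.
congr (_ * _); rewrite !expr2 /cs /sn !mulr_suml -big_split/=.
apply: eq_bigr => p _; rewrite !mulr_sumr -big_split/=; apply: eq_bigr => q _.
by rewrite expr0 mul1r mul0r addr0 /freq -mulrA mulrBl cosB.
Qed.

Lemma fejer_ge0 N t : 0 <= fejerd N 0 t.
Proof. by rewrite fejerE mulr_ge0 ?invr_ge0// addr_ge0 ?sqr_ge0. Qed.

Lemma fejerN N t : fejerd N 0 (- t) = fejerd N 0 t.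
Proof.
have -> : fejerd N 0 (- t) = N.+1%:R^-1 * (cs N.+1 t ^+ 2 + (- sn N.+1 t) ^+ 2).
  rewrite fejerE /cs /sn -sumrN; congr (_ * (_ ^+ 2 + _ ^+ 2)).
    by apply: eq_bigr => p _; rewrite !mulrN cosN.
  by apply: eq_bigr => p _; rewrite !mulrN sinN.
by rewrite sqrrN fejerE.
Qed.

(** Telescoping of the geometric sum: (1 - z) (1 + ... + z^(N-1)) = 1 - z^N,
    real and imaginary parts, for z on the unit circle. *)
Let cs_telescope N t :
  cs N t * (1 - cos (pi *+ 2 * t)) + sn N t * sin (pi *+ 2 * t) =
    1 - cos (N%:R * (pi *+ 2 * t))
  /\ sn N t * (1 - cos (pi *+ 2 * t)) - cs N t * sin (pi *+ 2 * t) =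
    - sin (N%:R * (pi *+ 2 * t)).
Proof.
elim: N => [|N [IHc IHs]].
  by rewrite /cs /sn !big_ord0 !mul0r cos0 sin0 oppr0; split; ring.
rewrite /cs /sn !big_ord_recr/= -/(cs N t) -/(sn N t).
have -> : N.+1%:R * (pi *+ 2 * t) = N%:R * (pi *+ 2 * t) + pi *+ 2 * t.
  by rewrite -natr1 mulrDl mul1r.
rewrite cosD sinD.
move: IHc IHs; set A := cs _ _; set B := sn _ _; set c := cos (pi *+ 2 * t).
set s := sin (pi *+ 2 * t); set cN := cos _; set sN := sin _.
move=> IHc IHs; split.
- have -> : (A + cN) * (1 - c) + (B + sN) * s =
    (A * (1 - c) + B * s) + (cN * (1 - c) + sN * s) by ring.
  by rewrite IHc; ring.
- have -> : (B + sN) * (1 - c) - (A + cN) * s =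
    (B * (1 - c) - A * s) + (sN * (1 - c) - cN * s) by ring.
  by rewrite IHs; ring.
Qed.

(** Take squared moduli in cs_telescope: |1 - z|^2 = 2 (1 - cos (2 pi t)). *)
Lemma fejer_concentrates N t :
  fejerd N 0 t * (1 - cos (pi *+ 2 * t)) <= 2 / N.+1%:R.
Proof.
have [hc hs] := cs_telescope N.+1 t.
rewrite fejerE -mulrA [2 / _]mulrC ler_wpM2l ?invr_ge0//.
have cs1 := sin2cos2 (pi *+ 2 * t).
have cs2 := sin2cos2 (N.+1%:R * (pi *+ 2 * t)).
have c2 := cos_geN1 (N.+1%:R * (pi *+ 2 * t)).
move: hc hs cs1 cs2 c2.
set A := cs _ _; set B := sn _ _; set c := cos (pi *+ 2 * t).
set s := sin (pi *+ 2 * t); set cN := cos _; set sN := sin _.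
move=> hc hs cs1 cs2 c2.
have : (A ^+ 2 + B ^+ 2) * (2 * (1 - c)) = 2 * (1 - cN).
  have -> : 2 * (1 - c) = (1 - c) ^+ 2 + s ^+ 2.
    by rewrite cs1; ring.
  have -> : 2 * (1 - cN) = (1 - cN) ^+ 2 + (- sN) ^+ 2.
    by rewrite sqrrN cs2; ring.
  by rewrite -hc -hs; ring.
lra.
Qed.

Notation U := (uniform_prob (@ltr01 R)).
Notation mu := (@lebesgue_measure R).

Lemma freq_neq0 N (p q : 'I_N) : p != q -> freq p q != 0.
Proof.
move=> pq; apply: mulf_neq0; first by rewrite subr_eq0 eqr_nat.
by rewrite mulrn_eq0/= gt_eqF ?pi_gt0.
Qed.

(** Over a full period only the constant terms p = q contribute. *)
Lemma fejer_Rmass N b : \int[U]_a fejerd N 0 (a - b) = 1.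
Proof.
pose F a : R := N.+1%:R^-1 * \sum_(p < N.+1) \sum_(q < N.+1)
  (if p == q then a else sin (freq p q * (a - b)) / freq p q).
have dF (a : R) : is_derive a (1 : R) F (fejerd N 0 (a - b)).
  pose f (p q : 'I_N.+1) (x : R) : R :=
    if p == q then x else sin (freq p q * (x - b)) / freq p q.
  have df (p q : 'I_N.+1) : is_derive a (1 : R) (f p q)
      (freq p q ^+ 0 * cos (freq p q * (a - b) + 0%:R * (pi / 2))).
    rewrite expr0 mul1r mul0r addr0 /f; case: eqVneq => [->|pq].
      by rewrite /freq subrr !mul0r cos0; exact: is_derive_id.
    apply: is_derive_eq; rewrite /GRing.scale/= ?scaler0 ?add0r ?mulr0 ?addr0.
    by field; exact: freq_neq0.
  have ds (p : 'I_N.+1) : is_derive a (1 : R) (fun x => \sum_(q < N.+1) f p q x)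
      (\sum_(q < N.+1)
        freq p q ^+ 0 * cos (freq p q * (a - b) + 0%:R * (pi / 2))).
    have -> : (fun x => \sum_(q < N.+1) f p q x) = \sum_(q < N.+1) f p q.
      by apply/funext => x; rewrite fct_sumE.
    exact: is_derive_sum.
  have dss : is_derive a (1 : R)
      (fun x => \sum_(p < N.+1) \sum_(q < N.+1) f p q x)
      (\sum_(p < N.+1) \sum_(q < N.+1)
        freq p q ^+ 0 * cos (freq p q * (a - b) + 0%:R * (pi / 2))).
    have -> : (fun x => \sum_(p < N.+1) \sum_(q < N.+1) f p q x) =
        \sum_(p < N.+1) (fun x => \sum_(q < N.+1) f p q x).
      by apply/funext => x; rewrite fct_sumE.
    exact: is_derive_sum.
  exact: is_deriveZ.
have cf : continuous (fun a => fejerd N 0 (a - b)).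
  move=> a; apply: (@continuous_comp _ _ _ (fun a : R => a - b)).
    by apply: continuousB; [exact: cvg_id|exact: cvg_cst].
  exact: fejerd_continuous.
rewrite (Rintegral_uniform_derive dF cf) /F -mulrBr -sumrB.
rewrite (eq_bigr (fun=> 1)) => [|p _].
  by rewrite sumr_const card_ord mulVf.
rewrite -sumrB (bigD1 p)//= eqxx subr0 big1 ?addr0// => q qp.
rewrite eq_sym (negbTE qp) (_ : 1 - b = 0 - b + 1); last by ring.
by rewrite mulrDr mulr1 sin_freq subrr.
Qed.

Lemma measurable_fejer_kernel N j :
  measurable_fun setT (fun z : measurableTypeR R * measurableTypeR R =>
    fejerd N j (z.1 - z.2)).
Proof.
apply: measurableT_comp; first exact: measurable_fejerd.
exact: measurable_funB.
Qed.

Lemma fejer_mass N b : (\int[U]_a (fejerd N 0 (a - b))%:E = 1)%E.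
Proof.
have [C hC] := fejerd_bounded N 0.
have I0 : L1 U (fun a => fejerd N 0 (a - b)).
  apply: (@L1_bdd _ _ _ _ _ C) => //.
  apply: measurableT_comp; first exact: measurable_fejerd.
  exact: measurable_funB.
transitivity ((\int[U]_a fejerd N 0 (a - b))%:E); last by rewrite fejer_Rmass.
by rewrite /Rintegral fineK//; exact: integrable_fin_num.
Qed.

(** Korovkin: at an interior point a, continuity controls |h b - h a| by
    e + C (1 - cos (2 pi (a - b))) for all b in [0, 1], and the Fejer kernel
    integrates 1 - cos to O(1/N). The end points are excluded because h need
    not be periodic. *)
Lemma fejer_cvg_continuous (h : R -> R) (M : R) : continuous h ->
  (forall x, `|h x| <= M) -> forall a, 0 < a < 1 ->
  kint U (fun x y => fejerd N 0 (x - y)) h a @[N --> \oo] --> h a.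
Proof.
move=> ch hM a /andP[a0 a1].
have M0 : 0 <= M by exact: le_trans (hM 0).
have mh : measurable_fun setT h by exact: continuous_measurable_fun.
have mfe N : measurable_fun setT (fun y : measurableTypeR R => fejerd N 0 (a - y)).
  by apply: measurableT_comp; [exact: measurable_fejerd|exact: measurable_funB].
have bd N (g : measurableTypeR R -> R) (D : R) : measurable_fun setT g ->
    (forall x, `|g x| <= D) -> L1 U (fun y => g y * fejerd N 0 (a - y)).
  move=> mg gD; have [C hC] := fejerd_bounded N 0.
  by apply: (@L1_bddM _ _ _ _ C) => //; exact: L1_bdd mg gD.
have mass N : \int[U]_y fejerd N 0 (a - y) = 1.
  under eq_Rintegral do rewrite -fejerN opprB.
  exact: fejer_Rmass.
apply/cvgrPdist_le => /= e e0.
pose e' := e / 2; have e'0 : 0 < e' by rewrite divr_gt0.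
have [r [r0 ra r1 hr]] : exists r : R, [/\ 0 < r, r <= a, r <= 1 - a &
    forall b, `|a - b| < r -> `|h a - h b| <= e'].
  have /cvgrPdist_le /(_ e' e'0) [/= r r0 hr] := ch a.
  exists (Num.min r (Num.min a (1 - a))).
  rewrite lt_min r0 lt_min a0 subr_gt0 a1 !ge_min !lexx !orbT; split=> // b.
  by rewrite lt_min => /andP[ab _]; exact: hr.
have pi0 := pi_gt0 R.
pose c := cos (pi *+ 2 * r).
have r2 : r <= 1 / 2 by lra.
have T0 : 0 < pi *+ 2 :> R by rewrite mulrn_wgt0.
have itv (x : R) : 0 <= x <= 1 / 2 -> pi *+ 2 * x \in `[0, pi].
  move=> /andP[x0 x1]; rewrite in_itv/= (mulr_ge0 (ltW T0) x0)/=.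
  by rewrite -mulr_natl; move: (pi : R) pi0 => p p0; nra.
have decr (x y : R) : 0 <= x -> x <= y -> y <= 1 / 2 ->
    cos (pi *+ 2 * y) <= cos (pi *+ 2 * x).
  move=> x0 xy y1; rewrite leNgt ltr_cos ?itv ?x0 ?y1 ?(le_trans x0 xy)//.
    by rewrite -leNgt ler_pM2l.
  exact: le_trans y1.
have c1 : c < 1.
  rewrite /c -cos0 ltr_cos ?itv ?(ltW r0)//; first by rewrite mulr_gt0.
  by rewrite in_itv/= lexx ltW.
(* the points of [0, 1] at distance >= r of a are at distance >= r of a modulo 1 *)
have far (b : R) : 0 <= b <= 1 -> r <= `|a - b| -> cos (pi *+ 2 * (a - b)) <= c.
  move=> /andP[b0 b1] rab.
  have abr : `|a - b| <= 1 - r by rewrite ler_norml; apply/andP; split; lra.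
  rewrite -cos_norm normrM (gtr0_norm T0).
  have [ab|ab] := leP `|a - b| (1 / 2); first by apply: decr => //; exact: ltW.
  rewrite -cosN -(@cosD2pi R).
  have -> : - (pi *+ 2 * `|a - b|) + pi *+ 2 = pi *+ 2 * (1 - `|a - b|) by ring.
  by apply: decr; lra.
pose C := 2 * M / (1 - c).
have C0 : 0 <= C by rewrite divr_ge0 ?mulr_ge0// subr_ge0 ltW.
have hC (b : R) : 0 <= b <= 1 ->
    `|h a - h b| <= e' + C * (1 - cos (pi *+ 2 * (a - b))).
  move=> b01; have [abr|abr] := ltP `|a - b| r.
    by rewrite (le_trans (hr _ abr))// lerDl mulr_ge0// subr_ge0 cos_le1.
  rewrite (@le_trans _ _ (2 * M))//.
    rewrite (le_trans (ler_normB _ _))// mulr_natl mulr2n lerD//.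
  rewrite (@le_trans _ _ (C * (1 - c)))//.
    by rewrite /C divfK// subr_eq0 gt_eqF.
  by rewrite ler_wpDl ?(ltW e'0)// ler_wpM2l// lerB// far.
near=> N.
have IF : L1 U (fun y => fejerd N 0 (a - y)).
  by have [D hD] := fejerd_bounded N 0; apply: (@L1_bdd _ _ _ _ _ D).
have IhF := bd N h M mh hM.
have IaF : L1 U (fun y => h a * fejerd N 0 (a - y)) by exact: L1Z.
have -> : h a - kint U (fun x y => fejerd N 0 (x - y)) h a =
    \int[U]_y (h a * fejerd N 0 (a - y) - h y * fejerd N 0 (a - y)).
  by rewrite RintegralB// RintegralZl// mass mulr1.
rewrite (le_trans (le_normr_Rintegral _ _))//; first exact: L1B.
apply: (@le_trans _ _
  (\int[U]_y (e' * fejerd N 0 (a - y) + C * (2 / N.+1%:R)))).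
  apply: ae_le_Rintegral.
  - exact/L1_norm/L1B.
  - by apply: L1D; [exact: L1Z|exact: finite_measure_integrable_cst].
  apply: filterS ae_uniform_itv => y /andP[y0 y1].
  rewrite -mulrBl normrM (ger0_norm (fejer_ge0 _ _)).
  have F0 := fejer_ge0 N (a - y).
  apply: (@le_trans _ _ ((e' + C * (1 - cos (pi *+ 2 * (a - y))))
                          * fejerd N 0 (a - y))).
    by rewrite ler_wpM2r// hC// !ltW.
  rewrite mulrDl lerD2l -mulrA ler_wpM2l// mulrC.
  exact: fejer_concentrates.
rewrite RintegralD//; last 2 first.
- exact: L1Z.
- exact: finite_measure_integrable_cst.
rewrite RintegralZl// mass mulr1 Rintegral_cst//.
have U1 : U setT = 1%E := probability_setT [the probability _ R of U].
rewrite [X in fine X]U1 mulr1.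
rewrite [leRHS](splitr e) lerD2l mulrA ler_pdivrMr ?ltr0n//.
rewrite -ler_pdivrMl//.
near: N; apply: filterS (nbhs_infty_ger (e'^-1 * (C * 2))) => N /le_trans; apply.
by rewrite ler_nat.
Unshelve. all: by end_near. Qed.

Lemma fejer_cvg_L1_continuous (h : R -> R) (M : R) : continuous h ->
  (forall x, `|h x| <= M) ->
  (\int[U]_x `|kint U (fun x y => fejerd N 0 (x - y)) h x - h x|%:E)%E
  @[N --> \oo] --> 0%E.
Proof.
move=> ch hM; have mh : measurable_fun setT h by exact: continuous_measurable_fun.
have Ih : L1 U h by apply: (@L1_bdd _ _ _ _ _ M).
pose f N (x : measurableTypeR R) :=
  `|kint U (fun x y => fejerd N 0 (x - y)) h x - h x|%:E.
have Ik N : L1 U (kint U (fun x y => fejerd N 0 (x - y)) h).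
  have [D hD] := fejerd_bounded N 0.
  by apply: (@L1_kint _ _ _ _ _ D (measurable_fejer_kernel N 0)).
have mf N : measurable_fun setT (f N).
  apply/measurable_EFinP; apply: measurableT_comp => //.
  exact: L1_measurable (L1B (Ik N) Ih).
have fcvg : {ae U, forall x, setT x -> f N x @[N --> \oo] --> 0%E}.
  apply: filterS ae_uniform_itv => x x01 _.
  apply: cvg_EFin; first exact: nearW.
  apply/norm_cvg0P; apply/subr_cvg0; exact: fejer_cvg_continuous hM _ x01.
have kM N x : `|kint U (fun x y => fejerd N 0 (x - y)) h x| <= M.
  have [D hD] := fejerd_bounded N 0.
  have mF : measurable_fun setT (fun y : measurableTypeR R => fejerd N 0 (x - y)).
    by apply: measurableT_comp; [exact: measurable_fejerd|exact: measurable_funB].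
  have IF : L1 U (fun y => fejerd N 0 (x - y)) by apply: (@L1_bdd _ _ _ _ _ D).
  have IhF : L1 U (fun y => h y * fejerd N 0 (x - y)) by apply: (@L1_bddM _ _ _ _ D).
  rewrite (le_trans (le_normr_Rintegral _ _))//.
  rewrite (@le_trans _ _ (\int[U]_y (M * fejerd N 0 (x - y))))//.
    apply: le_Rintegral => //; [exact: L1_norm|exact: L1Z|].
    by move=> y _; rewrite normrM (ger0_norm (fejer_ge0 _ _)) ler_wpM2r// fejer_ge0.
  rewrite RintegralZl//; under eq_Rintegral do rewrite -fejerN opprB.
  by rewrite fejer_Rmass mulr1.
have fM : {ae U, forall x N, setT x -> (`|f N x| <= (M + M)%:E)%E}.
  apply: aeW => x N _; rewrite /f lee_fin normr_id.
  by rewrite (le_trans (ler_normB _ _))// lerD.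
have IM : (U : {measure set _ -> \bar R}).-integrable setT (fun=> (M + M)%:E).
  exact: finite_measure_integrable_cst.
have [_ _] := dominated_convergence measurableT mf (measurable_cst _) fcvg IM fM.
by rewrite [X in _ --> X]integral0.
Qed.

Lemma cvge0_le (u : (\bar R)^nat) : (forall n, 0 <= u n)%E ->
  (forall e : R, 0 < e -> \forall n \near \oo, (u n <= e%:E)%E) ->
  u n @[n --> \oo] --> 0%E.
Proof.
move=> u0 ue; apply/fine_cvgP; split.
  apply: filterS (ue 1 ltr01) => n un; rewrite ge0_fin_numE//.
  exact: le_lt_trans un (ltry _).
apply/cvgrPdist_le => e e0; apply: filterS (ue e e0) => n un.
rewrite sub0r normrN ger0_norm ?fine_ge0//= -lee_fin fineK//.
by rewrite ge0_fin_numE// (le_lt_trans un) ?ltry.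
Qed.

(** Continuous functions are dense in L^1; composing with the projection onto
    [0, 1] makes the approximant bounded without changing it there. *)
Lemma uniform_L1_approx (v : R -> R) (e : R) : L1 U v -> 0 < e ->
  exists h : R -> R, exists M : R,
    [/\ continuous h, forall x, `|h x| <= M &
        (\int[U]_x `|v x - h x|%:E <= e%:E)%E].
Proof.
move=> Iv e0; have mv := L1_measurable Iv.
have mnv (w : R -> R) : measurable_fun setT w -> measurable_fun setT (fun x => `|w x|%:E).
  by move=> mw; apply/measurable_EFinP; exact: measurableT_comp.
have Iv01 : mu.-integrable `[0, 1] (EFin \o v).
  apply/integrableP; split.
    by apply/measurable_EFinP; exact: measurable_funTS.
  have := L1_norm_lty Iv; rewrite integral_uniform//; last exact: mnv.
  by rewrite subr0 invr1 mul1e.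
have mu01 : (mu `[0%R, 1%R] < +oo)%E.
  rewrite [X in (X < _)%E](lebesgue_measure_itv `[0%R, 1%R]).
  by rewrite /= lte_fin ltr01 -EFinB ltry.
have [g [cg _ g0]] := approximation_continuous_integrable
  (measurable_itv `[0%R, 1%R]) mu01 Iv01.
have : \forall n \near \oo,
    (\int[mu]_(z in `[0%R, 1%R]) `|(v z - g n z)%:E| <= e%:E)%E.
  have /fine_cvgP[gfin /cvgrPdist_le /(_ e e0)] := g0.
  apply: filterS2 gfin => n nfin.
  rewrite sub0r normrN ger0_norm ?fine_ge0 ?integral_ge0//= -lee_fin fineK//.
move=> [n _ /(_ n (leqnn n)) /= hn].
pose cl (x : R) : R := Num.max 0 (Num.min x 1).
have ccl : continuous cl.
  have cmin (x : R) : {for x, continuous (fun y : R => Num.min y 1)}.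
    exact: (@continuous_min _ _ (fun y : R => y) (fun=> 1) x (@cvg_id _ _)
      (@cst_continuous _ _ _ x)).
  move=> x.
  exact: (@continuous_max _ _ (fun=> 0) (fun y : R => Num.min y 1) x
    (@cst_continuous _ _ _ x) (cmin x)).
have cl01 x : 0 <= cl x <= 1 by rewrite /cl le_max lexx/= ge_max ler01 ge_min lexx orbT.
have [c _ gM] := EVT_max ler01 (continuous_subspaceT (fun x => cvg_norm (cg n x))).
have ch : continuous (g n \o cl).
  by move=> x; apply: continuous_comp; [exact: ccl|exact: cg].
exists (g n \o cl), `|g n c|; split => //.
  by move=> x; apply: gM; rewrite in_itv/=.
rewrite integral_uniform//; last first.
  apply: mnv; apply: measurable_funB => //; exact: continuous_measurable_fun.
rewrite subr0 invr1 mul1e; apply: le_trans hn.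
rewrite le_eqVlt; apply/orP; left; apply/eqP; apply: eq_integral => x.
rewrite inE/= in_itv/= => /andP[x0 x1]; rewrite /cl.
by rewrite (min_idPl x1) (max_idPr x0).
Qed.

(** Density of the continuous functions, the operators being contractions of L^1. *)
Lemma approx_id_fejer :
  approx_id [the probability _ R of U] (fun N x y => fejerd N 0 (x - y)).
Proof.
split.
- move=> N; exact: measurable_fejer_kernel.
- by move=> N x y; exact: fejer_ge0.
- move=> N; have [D hD] := fejerd_bounded N 0; exists D => x y.
  exact: le_trans (ler_norm _) (hD _).
- by move=> N y; exact: fejer_mass.
move=> v Iv; apply: cvge0_le => [N|e e0]; first exact: integral_ge0.
have e3 : 0 < e / 3 by rewrite divr_gt0.
have [h [M [ch hM vh]]] := uniform_L1_approx Iv e3.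
have Ih : L1 U h.
  by apply: (@L1_bdd _ _ _ _ _ M) => //; exact: continuous_measurable_fun.
have /fine_cvgP[cfin /cvgrPdist_le /(_ _ e3)] := fejer_cvg_L1_continuous ch hM.
apply: filterS2 cfin => N Nfin; rewrite sub0r normrN ger0_norm; last first.
  by rewrite fine_ge0// integral_ge0.
rewrite -lee_fin /= fineK// => hN.
have [D hD] := fejerd_bounded N 0.
have mk := measurable_fejer_kernel N 0.
have kD (x y : R) : `|fejerd N 0 (x - y)| <= D by exact: hD.
have Ivh : L1 U (fun x => v x - h x) by exact: L1B.
have triangle (A B c d : R) : `|A - c| <= `|A - B| + (`|B - d| + `|c - d|).
  have -> : A - c = (A - B) + ((B - d) - (c - d)) by ring.
  by rewrite (le_trans (ler_normD _ _))// lerD2l ler_normB.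
have Ikv := L1_kint mk kD Iv.
have Ikh := L1_kint mk kD Ih.
have Ikvh := L1_kint mk kD Ivh.
have mnv (w : measurableTypeR R -> R) : L1 U w ->
    measurable_fun setT (fun x => `|w x|%:E).
  by move=> /L1_measurable mw; apply/measurable_EFinP; exact: measurableT_comp.
apply: (@le_trans _ _ (\int[U]_x
   (`|kint U (fun x y => fejerd N 0 (x - y)) (fun y => v y - h y) x|%:E +
    (`|kint U (fun x y => fejerd N 0 (x - y)) h x - h x|%:E + `|v x - h x|%:E)))%E).
  apply: ge0_le_integral => //.
  - by apply: mnv; exact: L1B.
  - apply: emeasurable_funD; first exact: mnv.
    by apply: emeasurable_funD; apply: mnv => //; exact: L1B.
  - move=> x _; rewrite -!EFinD lee_fin (kintB mk kD _ Iv Ih).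
    exact: triangle.
rewrite ge0_integralD//; last 3 first.
- exact: mnv.
- by move=> x _; rewrite -EFinD lee_fin addr_ge0.
- by apply: emeasurable_funD; apply: mnv => //; exact: L1B.
rewrite ge0_integralD//; last 2 first.
- by apply: mnv; exact: L1B.
- exact: mnv.
have -> : e%:E = ((e / 3)%:E + ((e / 3)%:E + (e / 3)%:E))%E.
  by rewrite -!EFinD; congr EFin; field.
apply: leeD; last exact: leeD.
apply: le_trans vh; apply: (kint_contraction mk kD) => //.
  by move=> x y; exact: fejer_ge0.
by move=> y; exact: fejer_mass.
Qed.

End fejer.

(** * The Fejer kernel on the torus and the dissipation inequality *)

Section torus_kernel.
Context {R : realType}.
Notation U := (uniform_prob (@ltr01 R)).
Notation mu := (@lebesgue_measure R).

(** The mixed derivative of order J of the d-dimensional Fejer kernel, as a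
    function of x - y. *)
Definition tker d N (J : 'I_d -> nat) (x y : Rpt R d) : R :=
  \prod_(i < d) fejerd N (J i) (tnth x i - tnth y i).

Lemma measurable_tker d N J : measurable_fun setT
  (fun z : Rpt R d * Rpt R d => tker N J z.1 z.2).
Proof.
apply: measurable_prod => i _; apply: measurableT_comp.
  exact: measurable_fejerd.
apply: measurable_funB.
  exact: (measurableT_comp (measurable_tnth i) measurable_fst).
exact: (measurableT_comp (measurable_tnth i) measurable_snd).
Qed.

Lemma tker_bounded d N J : exists C, forall x y : Rpt R d, `|tker N J x y| <= C.
Proof.
have /choice[C hC] := fun i : 'I_d => @fejerd_bounded R N (J i).
exists (\prod_(i < d) C i) => x y; rewrite /tker normr_prod.
by apply: ler_prod => i _; rewrite normr_ge0 hC.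
Qed.

Lemma cons_pt_surj d (x : Rpt R d.+1) : exists z, @cons_pt R d z = x.
Proof.
exists (thead x, [tuple of behead x]).
by apply: val_inj => /=; rewrite [in RHS](tuple_eta x).
Qed.

(** The torus measure and the kernel are both built coordinate by coordinate. *)
Lemma approx_id_torus d :
  approx_id (torus_measure R d) (fun N => tker N (fun=> 0%N)).
Proof.
elim: d => [|d IHd].
  have tk N (x y : Rpt R 0) : tker N (fun=> 0%N) x y = 1 by rewrite /tker big_ord0.
  have x0 (x : Rpt R 0) : x = [tuple] by exact: tuple0.
  split.
  - by move=> N; exact: measurable_tker.
  - by move=> N x y; rewrite tk.
  - by move=> N; exists 1 => x y; rewrite tk.
  - move=> N y; under eq_integral do rewrite tk.
    by rewrite integral_cst// [X in (_ * X)%E](probability_setT (torus_measure R 0)) mule1.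
  - move=> v Iv.
    apply: cvg_near_cst; apply: nearW => N.
    apply: integral0_eq => x _; rewrite /kint.
    have vx y : v y = v x by rewrite (x0 x) (x0 y).
    under eq_Rintegral do rewrite tk mulr1 vx.
    rewrite Rintegral_cst// [X in fine X](probability_setT (torus_measure R 0)).
    by rewrite mulr1 subrr normr0.
have T := approx_id_tensor (@approx_id_fejer R) IHd.
apply: (approx_id_image (phi := @cons_pt R d) _ _ _ T).
- exact: cons_pt_surj.
- by move=> N; exact: measurable_tker.
- move=> N [a x] [b y]; rewrite /tker big_ord_recl/=; congr (_ * _).
  by apply: eq_bigr => i _; rewrite !tnthS.
Qed.

Lemma Rintegral_torusS d (F : Rpt R d.+1 -> R) (C : R) :
  measurable_fun setT F -> (forall x, `|F x| <= C) ->
  \int[torus_measure R d.+1]_x F x =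
  \int[(U \x torus_measure R d)%E]_z F (cons_pt z).
Proof.
move=> mF FC.
have mFE : measurable_fun setT (EFin \o F) by exact/measurable_EFinP.
rewrite /Rintegral; congr fine.
rewrite [LHS](@integral_pushforward _ _ _ _ _ (@cons_pt R d) _ _ setT _ mFE)//.
rewrite preimage_setT.
apply: (@L1_bdd _ _ _ [the probability _ R of (U \x torus_measure R d)%E] _ C) => //.
exact: measurableT_comp.
Qed.

Definition set_coord d (x : Rpt R d) (i : 'I_d) (a : measurableTypeR R) : Rpt R d :=
  [tuple if j == i then a else tnth x j | j < d].

Lemma set_coordS0 d a b (x : Rpt R d) : set_coord (cons_pt (b, x)) ord0 a = cons_pt (a, x).
Proof.
apply: eq_from_tnth => j; rewrite tnth_mktuple.
by case: (unliftP ord0 j) => [j' ->|->] //=; rewrite !tnthS.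
Qed.

Lemma set_coordSl d a b (x : Rpt R d) i :
  set_coord (cons_pt (b, x)) (lift ord0 i) a = cons_pt (b, set_coord x i a).
Proof.
apply: eq_from_tnth => j; rewrite tnth_mktuple.
case: (unliftP ord0 j) => [j' ->|->] //=; rewrite !tnthS tnth_mktuple.
by rewrite (inj_eq lift_inj).
Qed.

Lemma measurable_cons_ptl d (x : Rpt R d) :
  measurable_fun setT (fun a : measurableTypeR R => @cons_pt R d (a, x)).
Proof. exact: (measurableT_comp (@measurable_cons_pt R d) (pair2_measurable x)). Qed.

Lemma measurable_cons_ptr d a :
  measurable_fun setT (fun x : Rpt R d => @cons_pt R d (a, x)).
Proof. exact: (measurableT_comp (@measurable_cons_pt R d) (pair1_measurable a)). Qed.

(** A sign condition on all circles parallel to the i-th axis integrates to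
    the torus: by induction on d, Fubini's theorem makes the i-th coordinate
    the innermost one. *)
Lemma Rintegral_torus_le0 d (i : 'I_d) (F : Rpt R d -> R) (C : R) :
  measurable_fun setT F -> (forall x, `|F x| <= C) ->
  (forall x, \int[U]_a F (set_coord x i a) <= 0) ->
  \int[torus_measure R d]_x F x <= 0.
Proof.
have le0 d' (T : measurableType d') (P : probability T R) (f : T -> R) (D : R) :
    measurable_fun setT f -> (forall x, `|f x| <= D) -> (forall x, f x <= 0) ->
    \int[P]_x f x <= 0.
  move=> mf fD f0; have If := L1_bdd P mf fD.
  rewrite (le_trans (le_Rintegral measurableT If (L1Z 0 If) _))//.
    by move=> x _; rewrite mul0r.
  by rewrite RintegralZl// mul0r.
elim: d i F C => [[]//|d IHd] i F C mF FC Fi.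
rewrite (Rintegral_torusS mF FC).
pose UT := [the probability _ R of (U \x torus_measure R d)%E].
have IF : L1 UT (fun z => F (cons_pt z)).
  by apply: (@L1_bdd _ _ _ _ _ C) => //; exact: (measurableT_comp mF (@measurable_cons_pt R d)).
have C0 : 0 <= C by exact: le_trans (FC point).
have intC d' (T : measurableType d') (P : probability T R) (f : T -> R) :
    measurable_fun setT f -> (forall x, `|f x| <= C) -> `|\int[P]_x f x| <= C.
  move=> mf fC; have If := L1_bdd P mf fC.
  rewrite (le_trans (le_normr_Rintegral _ _))//.
  have IC : L1 P (fun=> C) by exact: finite_measure_integrable_cst.
  rewrite (le_trans (le_Rintegral measurableT (L1_norm If) IC _))//.
  by rewrite Rintegral_cst// [X in fine X]probability_setT mulr1.
case: (unliftP ord0 i) Fi => [j ->|->] Fi.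
- rewrite -(Rfubini1 IF).
  apply: (le0 _ _ _ _ C) => [||a].
  + exact: measurable_slice1 IF.
  + by move=> a; apply: intC => //; exact: (measurableT_comp mF (measurable_cons_ptr a)).
  apply: (IHd j _ C) => //; first exact: (measurableT_comp mF (measurable_cons_ptr a)).
  move=> x; under eq_Rintegral do rewrite -set_coordSl.
  exact: Fi.
- rewrite -(Rfubini2 IF).
  apply: (le0 _ _ _ _ C) => [||x].
  + exact: measurable_slice2 IF.
  + by move=> x; apply: intC => //; exact: (measurableT_comp mF (measurable_cons_ptl x)).
  under eq_Rintegral do rewrite -(set_coordS0 _ point).
  exact: Fi.
Qed.

(** Integrate (beta(r0) r1)' = beta'(r0) r1^2 + beta(r0) r2 over a period; the
    first term is nonnegative since beta is increasing. *)
Lemma periodic_dissipation (r0 r1 r2 : R -> R) :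
  (forall a : R, is_derive a (1 : R) r0 (r1 a)) ->
  (forall a : R, is_derive a (1 : R) r1 (r2 a)) ->
  continuous r2 -> r0 1 = r0 0 -> r1 1 = r1 0 ->
  \int[U]_a (beta (r0 a) * r2 a) <= 0.
Proof.
move=> d0 d1 c2 p0 p1.
have c0 : continuous r0.
  by move=> a; apply: differentiable_continuous; apply/derivable1_diffP; case: (d0 a).
have c1 : continuous r1.
  by move=> a; apply: differentiable_continuous; apply/derivable1_diffP; case: (d1 a).
pose f a := r1 a ^+ 2 / jap (r0 a) ^+ 3.
pose g a := beta (r0 a) * r2 a.
have cf : continuous f.
  move=> a; apply: cvgM; first by apply: cvgM; exact: c1.
  apply: cvgV; first by rewrite expf_neq0// gt_eqF// jap_gt0.
  have cj : r0 @ a --> r0 a := c0 a.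
  have cjap : jap (r0 b) @[b --> a] --> jap (r0 a).
    apply: (@continuous_comp _ _ _ (fun b => 1 + r0 b ^+ 2) Num.sqrt).
      by apply: cvgD; [exact: cvg_cst|apply: cvgM].
    exact: sqrt_continuous.
  by rewrite /exprz; do 2 apply: cvgM => //.
have cg : continuous g.
  move=> a; apply: cvgM; last exact: c2.
  by apply: continuous_comp; [exact: c0|exact: beta_continuous].
have dF (a : R) : is_derive a (1 : R) (fun b => beta (r0 b) * r1 b) (f a + g a).
  have db := @is_derive1_comp _ beta r0 a _ _ (is_derive_beta (r0 a)) (d0 a).
  have := is_deriveM db (d1 a) => dM; apply: (is_derive_eq dM).
  by rewrite /f /g /GRing.scale/= addrC; congr (_ + _); ring.
have cfg : continuous (fun a => f a + g a) by move=> a; apply: cvgD; [exact: cf|exact: cg].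
have := Rintegral_uniform_derive dF cfg.
rewrite p0 p1 subrr.
rewrite !Rintegral_uniform; last 2 first.
- exact: continuous_measurable_fun.
- exact: continuous_measurable_fun.
have I (h : R -> R) : continuous h -> mu.-integrable `[0, 1] (EFin \o h).
  move=> ch; apply: continuous_compact_integrable; first exact: segment_compact.
  exact: continuous_subspaceT.
rewrite RintegralD//; [|exact: I|exact: I].
move/eqP; rewrite addrC addr_eq0 => /eqP ->.
rewrite oppr_le0 Rintegral_ge0// => a _.
by rewrite divr_ge0 ?sqr_ge0// exprn_ge0// ltW// jap_gt0.
Qed.

Section convolution.
Variables (d : nat) (P : probability (Rpt R d) R) (rho : Rpt R d -> R).
Hypothesis Irho : L1 P rho.
Variables (N : nat) (i : 'I_d).

Let conv j (a : R) := \int[P]_y (rho y * fejerd N j (a - tnth y i)).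

Let measurable_sh j (a : R) :
  measurable_fun setT (fun y : Rpt R d => fejerd N j (a - tnth y i)).
Proof.
apply: measurableT_comp; first exact: measurable_fejerd.
by apply: measurable_funB => //; exact: measurable_tnth.
Qed.

Let is_derive_sh j (y : Rpt R d) (a : R) :
  is_derive a (1 : R) (fun b => rho y * fejerd N j (b - tnth y i))
    (rho y * fejerd N j.+1 (a - tnth y i)).
Proof.
have d1 : is_derive a (1 : R) (fun b => b - tnth y i) 1.
  by apply: is_derive_eq; rewrite subr0.
have d2 := @is_derive1_comp _ (fejerd N j) (fun b => b - tnth y i) a _ _
  (is_derive_fejerd N j (a - tnth y i)) d1.
by have d3 := is_deriveZ (rho y) d2; apply: (is_derive_eq d3); rewrite mulr1.
Qed.

(** Differentiation under the integral sign, rho being integrable. *)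
Lemma is_derive_conv j (a : R) : is_derive a (1 : R) (conv j) (conv j.+1 a).
Proof.
have [C hC] := @fejerd_bounded R N j; have [D hD] := @fejerd_bounded R N j.+1.
pose f (b : R) (y : Rpt R d) := rho y * fejerd N j (b - tnth y i).
have Ia : `](a - 1), (a + 1)[%classic a by rewrite /= in_itv/= ltrBlDr ltrDl ltr01.
have If b : `](a - 1), (a + 1)[%classic b -> P.-integrable setT (EFin \o f b).
  by move=> _; apply: (@L1_bddM _ _ _ _ C).
have df b y : `](a - 1), (a + 1)[%classic b -> setT y -> derivable (f^~ y) b 1.
  by move=> _ _; case: (is_derive_sh j y b).
have d1f b y : partial1of2 f b y = rho y * fejerd N j.+1 (b - tnth y i).
  by rewrite partial1of2E; case: (is_derive_sh j y b).
pose G y := D * `|rho y|.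
have G0 y : 0 <= G y by rewrite mulr_ge0// (le_trans _ (hD 0)).
have IG : P.-integrable setT (EFin \o G) by exact/L1Z/L1_norm.
have fG b y : `](a - 1), (a + 1)[%classic b -> setT y -> `|partial1of2 f b y| <= G y.
  by move=> _ _; rewrite d1f normrM /G mulrC ler_wpM2r.
apply: DeriveDef.
  exact: (derivable_under_integral measurableT Ia If df G0 IG fG).
rewrite -derive1E.
rewrite [LHS](differentiation_under_integral measurableT Ia If df G0 IG fG).
by apply: eq_Rintegral => y _; rewrite d1f.
Qed.

Lemma conv_periodic j : conv j 1 = conv j 0.
Proof.
apply: eq_Rintegral => y _; rewrite -(fejerd_periodic N j (0 - tnth y i)).
by congr (_ * fejerd _ _ _); ring.
Qed.

Lemma conv_dissipation : \int[U]_a (beta (conv 0 a) * conv 2 a) <= 0.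
Proof.
apply: (@periodic_dissipation _ (conv 1)).
- exact: is_derive_conv.
- exact: is_derive_conv.
- move=> a; apply: differentiable_continuous; apply/derivable1_diffP.
  by case: (is_derive_conv 2 a).
- exact: conv_periodic.
- exact: conv_periodic.
Qed.

End convolution.

Definition order_at d (i : 'I_d) (j : nat) : 'I_d -> nat :=
  fun l => if l == i then j else 0%N.

Lemma kint_set_coord d N (v : Rpt R d -> R) (i : 'I_d) j (x : Rpt R d) a :
  kint (torus_measure R d) (tker N (order_at i j)) v (set_coord x i a) =
  \int[torus_measure R d]_y
    ((v y * \prod_(l < d | l != i) fejerd N 0 (tnth x l - tnth y l))
     * fejerd N j (a - tnth y i)).
Proof.
apply: eq_Rintegral => y _; rewrite /tker (bigD1 i)//= /order_at eqxx.
rewrite tnth_mktuple eqxx [in RHS]mulrAC mulrA; congr (_ * _).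
by apply: eq_bigr => l /negbTE li; rewrite li tnth_mktuple li.
Qed.

Lemma order_at0 d (i : 'I_d) : order_at i 0 = fun=> 0%N.
Proof. by apply/funext => l; rewrite /order_at; case: eqP. Qed.

(** Along a circle parallel to the i-th axis the smoothing of v is a periodic
    function of one variable, and the second factor is its second derivative,
    so periodic_dissipation applies. *)
Lemma torus_dissipation d N (v : Rpt R d -> R) (i : 'I_d) :
  L1 (torus_measure R d) v ->
  \int[torus_measure R d]_x
    (beta (kint (torus_measure R d) (tker N (fun=> 0%N)) v x) *
     kint (torus_measure R d) (tker N (order_at i 2)) v x) <= 0.
Proof.
move=> Iv; set P := torus_measure R d.
have Ik J : measurable_fun setT (kint P (tker N J) v).
  have [C hC] := tker_bounded N J.
  exact: L1_measurable (L1_kint (measurable_tker N J) hC Iv).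
have [D hD] := tker_bounded N (order_at i 2).
apply: (@Rintegral_torus_le0 _ i _ (\int[P]_y `|v y| * D)).
- apply: measurable_funM => //; apply: measurableT_comp => //.
  exact: measurable_beta.
- move=> x; rewrite normrM -[leRHS]mul1r ler_pM ?normr_beta//.
  have Ivk := L1_kernel (measurable_tker N (order_at i 2)) hD x Iv.
  rewrite (le_trans (le_normr_Rintegral _ _))// -RintegralZr//; last exact: L1_norm.
  apply: le_Rintegral => //; first exact: L1_norm.
    have := L1Z D (L1_norm Iv).
    by apply: eq_integrable => // y _ /=; rewrite mulrC.
  by move=> y _; rewrite normrM ler_wpM2l.
move=> x; rewrite -(order_at0 i).
under eq_Rintegral do rewrite !kint_set_coord.
apply: conv_dissipation.
have [C hC] : exists C, forall t, `|@fejerd R N 0 t| <= C by exact: fejerd_bounded.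
apply: (@L1_bddM _ _ _ _ (\prod_(l < d | l != i) C)) => //.
- under eq_fun do rewrite big_mkcond/=.
  apply: measurable_prod => l _; case: (l != i) => //; apply: measurableT_comp.
    exact: measurable_fejerd.
  by apply: measurable_funB => //; exact: measurable_tnth.
- by move=> y; rewrite normr_prod; apply: ler_prod => l _; rewrite normr_ge0 hC.
Qed.

End torus_kernel.

(** * Passage to the limit in the nonlinear term *)

Section limit_passage.
Context {d} {Z : measurableType d} {R : realType}.
Variable m : {measure set Z -> \bar R}.

(** Dominated convergence as M tends to infinity. *)
Lemma L1_tail (g : Z -> R) (e : R) : L1 m g -> 0 < e ->
  exists M : nat, \int[m]_z (`|g z| * \1_[set z | M%:R < `|g z|] z) <= e.
Proof.
move=> Ig e0; have mg := L1_measurable Ig.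
have mng : measurable_fun setT (fun z => `|g z|) by exact: measurableT_comp.
pose A (M : nat) := [set z | M%:R < `|g z|].
have mA M : measurable (A M).
  rewrite -[A M]setTI; exact: (measurable_fun_ltr (measurable_cst _) mng).
pose f M z : R := `|g z| * \1_(A M) z.
have mf M : measurable_fun setT (f M) by exact: measurable_funM.
have mEf M : measurable_fun setT (EFin \o f M) by exact/measurable_EFinP.
have f0 : {ae m, forall z, setT z -> (EFin \o f n) z @[n --> \oo] --> 0%E}.
  apply: aeW => z _; apply: cvg_near_cst.
  apply: filterS (nbhs_infty_ger `|g z|) => M gM.
  by rewrite /f /= indicE memNset ?mulr0//= /A/=; apply/negP; rewrite -leNgt.
have fg : {ae m, forall z n, setT z -> (`|(EFin \o f n) z| <= `|g z|%:E)%E}.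
  apply: aeW => z M _; rewrite /f /= lee_fin normrM normr_id ler_piMr//.
  by rewrite indicE; case: (_ \in _); rewrite ?normr1 ?normr0.
have Ing : m.-integrable setT (fun z => `|g z|%:E) by exact: L1_norm.
have [_ _] := dominated_convergence measurableT mEf (measurable_cst _) f0 Ing fg.
rewrite [X in _ --> X]integral0 => /fine_cvgP[_ /cvgrPdist_le /(_ e e0)][M _ hM].
exists M.
have := hM M (leqnn M); rewrite /= sub0r normrN; apply: le_trans.
exact: ler_norm.
Qed.

(** The nonlinear term beta(W) g is continuous along L^1 convergence of both
    factors: beta is bounded and Lipschitz, and g is split into a bounded part
    and an L^1-small tail. *)
Lemma beta_limit (W g : Z -> R) (u v : nat -> Z -> R) :
  L1 m W -> L1 m g -> (forall n, L1 m (u n)) -> (forall n, L1 m (v n)) ->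
  (\int[m]_z `|u n z - W z|) @[n --> \oo] --> 0 ->
  (\int[m]_z `|v n z - g z|) @[n --> \oo] --> 0 ->
  (forall n, \int[m]_z (v n z * beta (u n z)) <= 0) ->
  \int[m]_z (g z * beta (W z)) <= 0.
Proof.
move=> IW Ig Iu Iv uW vg le0; apply/ler_addgt0Pr => e e0; rewrite add0r.
have e4 : 0 < e / 4 by rewrite divr_gt0.
have [M hM] := L1_tail Ig e4.
have M1 : 0 < M%:R + 1 :> R by rewrite ltr_wpDl.
have mb (w : Z -> R) : L1 m w -> measurable_fun setT (fun z => beta (w z)).
  by move=> /L1_measurable mw; exact: (measurableT_comp (@measurable_beta R) mw).
have Ib f w : L1 m f -> L1 m w -> L1 m (fun z => f z * beta (w z)).
  move=> If Iw; apply: (@L1_bddM _ _ _ _ 1) => //; first exact: mb.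
  by move=> z; exact: normr_beta.
have mng : measurable_fun setT (fun z => `|g z|).
  by apply: measurableT_comp => //; exact: L1_measurable Ig.
have It : L1 m (fun z => `|g z| * \1_[set z | M%:R < `|g z|] z).
  apply: (@L1_bddM _ _ _ _ 1); last exact: L1_norm.
  - apply: measurable_indic; rewrite -[X in measurable X]setTI.
    exact: (measurable_fun_ltr (measurable_cst _) mng).
  - by move=> z; rewrite indicE; case: (_ \in _); rewrite ?normr1 ?normr0.
have uW' : \forall n \near \oo, \int[m]_z `|u n z - W z| <= e / 4 / (M%:R + 1).
  have /cvgrPdist_le /(_ _ (divr_gt0 e4 M1)) := uW; apply: filterS => n.
  by rewrite sub0r normrN => /(le_trans (ler_norm _)).
have vg' : \forall n \near \oo, \int[m]_z `|v n z - g z| <= e / 4.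
  have /cvgrPdist_le /(_ _ e4) := vg; apply: filterS => n.
  by rewrite sub0r normrN => /(le_trans (ler_norm _)).
have [n [hu hv]] : exists n, \int[m]_z `|u n z - W z| <= e / 4 / (M%:R + 1) /\
    \int[m]_z `|v n z - g z| <= e / 4.
  by have [n _ /(_ n (leqnn n))] := filterI uW' vg'; exists n.
have IuW : L1 m (fun z => `|u n z - W z|) by exact/L1_norm/L1B.
have Ivg : L1 m (fun z => `|v n z - g z|) by exact/L1_norm/L1B.
have IMu : L1 m (fun z => (M%:R + 1) * `|u n z - W z|) by exact: L1Z.
have I2t := L1Z 2 It.
have S1 := L1D (Ib _ _ (Iv n) (Iu n)) Ivg.
have S2 := L1D S1 IMu.
have S3 := L1D S2 I2t.
apply: (@le_trans _ _ (\int[m]_z (v n z * beta (u n z) + `|v n z - g z|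
   + (M%:R + 1) * `|u n z - W z|
   + 2 * (`|g z| * \1_[set z | M%:R < `|g z|] z)))).
  apply: le_Rintegral => //; first exact: Ib.
  move=> z _.
  have bW := normr_beta (W z); have bu := normr_beta (u n z).
  have bl := beta_lipschitz (W z) (u n z).
  have -> : g z * beta (W z) = v n z * beta (u n z)
      - (v n z - g z) * beta (u n z) + g z * (beta (W z) - beta (u n z)) by ring.
  rewrite -!addrA lerD2l; apply: lerD.
    rewrite (le_trans (ler_norm _))// normrN normrM ler_piMr//.
  rewrite (le_trans (ler_norm _))// normrM indicE.
  have [gM|gM] := ltP M%:R `|g z|.
    rewrite mem_set//= mulr1 ler_wpDl ?mulr_ge0 ?(ltW M1)//.
    rewrite mulrC ler_wpM2r//.
    by rewrite (le_trans (ler_normB _ _))// -[leRHS]/(1 + 1) lerD.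
  rewrite memNset/=; last by apply/negP; rewrite -leNgt.
  rewrite !mulr0 addr0 ler_pM//; last by rewrite [leRHS]distrC.
  by rewrite (le_trans gM)// lerDl.
rewrite RintegralD// RintegralD// RintegralD//; last exact: Ib.
rewrite !RintegralZl//.
have hu' : (M%:R + 1) * \int[m]_z `|u n z - W z| <= e / 4.
  by rewrite mulrC -ler_pdivlMr.
have := le0 n; move: hu' hv hM.
set x1 := Rintegral _ _ _; set x2 := Rintegral _ _ _; set x3 := Rintegral _ _ _.
set x4 := Rintegral _ _ _.
lra.
Qed.

End limit_passage.

(** * The energy argument *)

Lemma ae_exists_itv {R : realType} (Q : measurableTypeR R -> Prop) (a b : R) :
  a < b -> {ae @lebesgue_measure R, forall t, Q t} ->
  exists t : R, a < t < b /\ Q t.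
Proof.
move=> ab [N [mN N0 QN]]; apply: contrapT => noQ.
have abN : `]a, b[ `<=` N.
  move=> t; rewrite /= in_itv/= => tab; apply: QN => Qt.
  by apply: noQ; exists t.
have : (lebesgue_measure `]a, b[ <= lebesgue_measure N)%E.
  by apply: le_measure => //; rewrite inE.
rewrite [X in (_ <= X)%E]N0 [X in (X <= _)%E](lebesgue_measure_itv `]a, b[).
by rewrite /= lte_fin ab -EFinB lee_fin subr_le0 leNgt ab.
Qed.

Section energy_argument.
Context {R : realType} (d : nat).
Notation L := (@lebesgue_measure R).
Notation P := (torus_measure R d).
Notation X := (Rpt R d).

Definition laplace_ker N (x y : X) : R := \sum_(i < d) tker N (order_at i 2) x y.

Lemma measurable_laplace_ker N : measurable_fun setT (fun z : X * X => laplace_ker N z.1 z.2).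
Proof. by apply: measurable_sum => i; exact: measurable_tker. Qed.

Lemma laplace_ker_bounded N : exists C, forall x y : X, `|laplace_ker N x y| <= C.
Proof.
have /choice[C hC] := fun i : 'I_d => @tker_bounded R d N (order_at i 2).
exists (\sum_(i < d) C i) => x y.
by rewrite (le_trans (ler_norm_sum _ _ _))// ler_sum.
Qed.

(** Sum of the dissipations in the coordinate directions. *)
Lemma laplacian_dissipation N (v : X -> R) : L1 P v ->
  \int[P]_x (kint P (laplace_ker N) v x * beta (kint P (tker N (fun=> 0%N)) v x)) <= 0.
Proof.
move=> Iv.
have Ik J : L1 P (kint P (tker N J) v).
  have [C hC] := @tker_bounded R d N J.
  exact: (L1_kint (measurable_tker N J) hC).
have Ikb i : L1 P (fun x => beta (kint P (tker N (fun=> 0%N)) v x) *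
    kint P (tker N (order_at i 2)) v x).
  under eq_fun do rewrite mulrC.
  apply: (L1_bddM (C := 1)) => // [|x]; last exact: normr_beta.
  exact: (measurableT_comp (@measurable_beta R) (L1_measurable (Ik _))).
rewrite (_ : Rintegral _ _ _ = \sum_(i < d) \int[P]_x
    (beta (kint P (tker N (fun=> 0%N)) v x) *
     kint P (tker N (order_at i 2)) v x)).
  by rewrite big_seq sumr_le0// => i _; exact: torus_dissipation.
rewrite -Rintegral_sum//; apply: eq_Rintegral => x _.
rewrite -mulr_sumr mulrC; congr (_ * _).
rewrite /kint -Rintegral_sum.
  by apply: eq_Rintegral => y _; rewrite /laplace_ker mulr_sumr.
move=> i; have [C hC] := @tker_bounded R d N (order_at i 2).
exact: (L1_kernel (measurable_tker N _) hC).
Qed.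

(** In the application W = chi (u1 - u2) and
    g = chi (u1^n - u2^n) - chi' (u1 - u2), where the cutoff chi vanishes after
    time c, so that W solves the heat equation with source - g and zero initial
    value. The hypothesis [weak] is this equation tested with the kernel
    centred at x: testing and smoothing are the same operation. *)
Variables (W g : measurableTypeR R * X -> R) (c T : R).
Hypotheses (IW : L1 (L \x P)%E W) (Ig : L1 (L \x P)%E g).
Hypotheses (c0 : 0 < c) (cT : c < T).
Hypothesis W0 : forall (s : R) y, ~~ (0 < s < c) -> W (s, y) = 0.
Hypothesis g0 : forall (s : R) y, ~~ (0 < s < c) -> g (s, y) = 0.

Notation K N := (tker N (fun=> 0%N)).

Hypothesis weak : forall N x, {ae L, forall t : measurableTypeR R, 0 < t < T ->
  \int[P]_y (W (t, y) * K N x y) =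
  \int[L]_(s in `]0, t[) \int[P]_y (W (s, y) * laplace_ker N x y - g (s, y) * K N x y)}.

Section fixed_order.
Variable N : nat.

Let KW (z : measurableTypeR R * X) := kint P (K N) (fun y => W (z.1, y)) z.2.
Let Kg (z : measurableTypeR R * X) := kint P (K N) (fun y => g (z.1, y)) z.2.
Let LW (z : measurableTypeR R * X) := kint P (laplace_ker N) (fun y => W (z.1, y)) z.2.

Let IKW : L1 (L \x P)%E KW.
Proof.
have [C hC] := @tker_bounded R d N (fun=> 0%N).
exact: (L1_kint_slices (measurable_tker N _) hC IW).
Qed.

Let IKg : L1 (L \x P)%E Kg.
Proof.
have [C hC] := @tker_bounded R d N (fun=> 0%N).
exact: (L1_kint_slices (measurable_tker N _) hC Ig).
Qed.

Let ILW : L1 (L \x P)%E LW.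
Proof.
have [C hC] := laplace_ker_bounded N.
exact: (L1_kint_slices (measurable_laplace_ker N) hC IW).
Qed.

Let f x (z : measurableTypeR R * X) := W z * laplace_ker N x z.2 - g z * K N x z.2.

Let If x : L1 (L \x P)%E (f x).
Proof.
have [C hC] := @tker_bounded R d N (fun=> 0%N).
have [D hD] := laplace_ker_bounded N.
apply: L1B.
  apply: (L1_bddM (C := D)) => //.
  exact: (measurableT_comp (measurable_kernelr (measurable_laplace_ker N) x) measurable_snd).
apply: (L1_bddM (C := C)) => //.
exact: (measurableT_comp (measurable_kernelr (measurable_tker N _) x) measurable_snd).
Qed.

Let h x s := \int[P]_y f x (s, y).

Let Ih x : L1 L (h x).
Proof. exact: L1_slice1 (If x). Qed.

Let hE x : {ae L, forall s, h x s = LW (s, x) - Kg (s, x)}.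
Proof.
have aeW : {ae L, forall s, L1 P (fun y => W (s, y))} := ae_integrable1 IW.
have aeg : {ae L, forall s, L1 P (fun y => g (s, y))} := ae_integrable1 Ig.
have [C hC] := @tker_bounded R d N (fun=> 0%N).
have [D hD] := laplace_ker_bounded N.
apply: filterS2 aeW aeg => s Ws gs.
rewrite /h /f /LW /Kg /kint RintegralB//=.
  exact: (L1_kernel (measurable_laplace_ker N) hD).
exact: (L1_kernel (measurable_tker N _) hC).
Qed.

Let bKW := fun z => beta (KW z).

Let mbKW : measurable_fun setT bKW.
Proof. exact: (measurableT_comp (@measurable_beta R) (L1_measurable IKW)). Qed.

Let IbKW F : L1 (L \x P)%E F -> L1 (L \x P)%E (fun z => F z * bKW z).
Proof.
by apply: (L1_bddM (C := 1)) => // z; exact: normr_beta.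
Qed.

(** The energy balance at a fixed point x: the trajectory t |-> K W (t, x) is
    absolutely continuous and vanishes both at time 0 and after time c. *)
Let energy_at x : 0 <= \int[L]_s ((LW (s, x) - Kg (s, x)) * bKW (s, x)).
Proof.
pose V t := \int[L]_(s in `[0, t]) h x s.
have VE : {ae L, forall t : measurableTypeR R, 0 < t < T -> KW (t, x) = V t}.
  apply: filterS (weak N x) => t /[apply]; rewrite /KW /kint /= => ->.
  rewrite /V Rintegral_itv_bndo_bndc; last exact: integrableS (Ih x).
  by rewrite Rintegral_itv_obnd_cbnd//; exact: integrableS (Ih x).
(* any time after c will do, because W vanishes from then on *)
have [t [/andP[ct tT] tV]] := ae_exists_itv cT VE.
have t0 : 0 < t by exact: lt_trans ct.
have out s y : ~~ (0 < s < c) -> (LW (s, y) - Kg (s, y)) * bKW (s, y) = 0.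
  move=> sc; rewrite /LW /Kg /kint /=.
  under eq_Rintegral do rewrite W0// mul0r.
  under [X in _ - X]eq_Rintegral do rewrite g0// mul0r.
  by rewrite !Rintegral_cst// !mul0r subrr mul0r.
have Vt : V t = 0.
  rewrite -tV ?t0 ?tT// /KW /kint /=.
  under eq_Rintegral do rewrite W0 ?mul0r ?negb_and -?leNgt ?(ltW ct) ?orbT//.
  by rewrite Rintegral_cst// mul0r.
have := jap_primitive_le (Ih x) (ltW t0).
rewrite -/(V t) Vt jap0 subrr; move/le_trans; apply.
rewrite le_eqVlt; apply/orP; left; apply/eqP.
rewrite Rintegral_mkcond; apply: ae_Rintegral.
- apply/(measurable_restrictT _ _).1 => //.
  have /integrableP[/measurable_EFinP] := integrable_betaV (Ih x) (lexx 0) (ltW t0).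
  exact.
- apply: measurable_funM; last exact: (measurableT_comp mbKW (pair2_measurable x)).
  apply: measurable_funB.
    exact: (measurableT_comp (L1_measurable ILW) (pair2_measurable x)).
  exact: (measurableT_comp (L1_measurable IKg) (pair2_measurable x)).
apply: filterS2 VE (hE x) => s Vs hs; rewrite patchE; case: ifPn.
  rewrite inE /= in_itv/= => /andP[s0 st].
  by rewrite hs mulrC -[X in beta X]/(V s) -Vs ?s0 ?(le_lt_trans st).
rewrite notin_setE/= in_itv/= => /negP st; rewrite out//.
apply: contra st => /andP[-> sc]; exact: ltW (lt_trans sc ct).
Qed.

Let dissipation : \int[(L \x P)%E]_z (LW z * bKW z) <= 0.
Proof.
have I1 := IbKW ILW.
rewrite -(Rfubini1 I1).
have I0 : L1 L (fun=> 0 : R) by exact: integrable0.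
rewrite (le_trans (ae_le_Rintegral (L1_slice1 I1) I0 _))//; last first.
  by rewrite Rintegral_cst// mul0r.
have aeW : {ae L, forall s, L1 P (fun y => W (s, y))} := ae_integrable1 IW.
by apply: filterS aeW => s; exact: laplacian_dissipation.
Qed.

(** Integrating energy_at over x and exchanging the integrals leaves the
    dissipation, which has a sign, and the nonlinear term. *)
Lemma energy_estimate : \int[(L \x P)%E]_z (Kg z * bKW z) <= 0.
Proof.
have ILg : L1 (L \x P)%E (fun z => (LW z - Kg z) * bKW z) by exact/IbKW/L1B.
have le1 : 0 <= \int[(L \x P)%E]_z ((LW z - Kg z) * bKW z).
  rewrite -(Rfubini2 ILg); apply: Rintegral_ge0 => x _; exact: energy_at.
move: le1; under eq_Rintegral do rewrite mulrBl.
rewrite (RintegralB measurableT (IbKW ILW) (IbKW IKg)).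
by rewrite subr_ge0 => /le_trans; apply; exact: dissipation.
Qed.

End fixed_order.

(** Limit of energy_estimate as the order of the kernel tends to infinity. *)
Lemma nonlinear_term_le0 : \int[(L \x P)%E]_z (g z * beta (W z)) <= 0.
Proof.
have cvgR (F : measurableTypeR R * X -> R) : L1 (L \x P)%E F ->
    (\int[(L \x P)%E]_z
      `|kint P (K n) (fun y => F (z.1, y)) z.2 - F z|) @[n --> \oo] --> 0.
  move=> IF; have /fine_cvgP[_] := ai_cvg_slices (approx_id_torus d) IF.
  apply: cvg_trans; apply: near_eq_cvg; apply: nearW => n /=.
  have [C hC] := @tker_bounded R d n (fun=> 0%N).
  have IKF := L1_kint_slices (measurable_tker n _) hC IF.
  rewrite /Rintegral; congr fine; apply/esym.
  apply: (@fubini_tonelli1 _ _ _ _ _ L P (fun z => `|_|%:E)) => //.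
  apply/measurable_EFinP; apply: measurableT_comp => //.
  exact: L1_measurable (L1B IKF IF).
have IK (F : measurableTypeR R * X -> R) n : L1 (L \x P)%E F ->
    L1 (L \x P)%E (fun z => kint P (K n) (fun y => F (z.1, y)) z.2).
  move=> IF; have [C hC] := @tker_bounded R d n (fun=> 0%N).
  exact: (L1_kint_slices (measurable_tker n _) hC IF).
apply: (beta_limit IW Ig (fun n => IK _ n IW) (fun n => IK _ n Ig)).
- exact: cvgR.
- exact: cvgR.
- exact: energy_estimate.
Qed.

Lemma nonlinear_term_ae0 : (forall z, 0 <= g z * beta (W z)) ->
  {ae (L \x P)%E, forall z, g z * beta (W z) = 0}.
Proof.
move=> ge0; pose F z := g z * beta (W z).
have Igb : L1 (L \x P)%E F.
  apply: (L1_bddM (C := 1)) => //; last by move=> z; exact: normr_beta.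
  exact: (measurableT_comp (@measurable_beta R) (L1_measurable IW)).
have mgb : measurable_fun setT (EFin \o F).
  exact/measurable_EFinP/L1_measurable/Igb.
have F0 : (\int[(L \x P)%E]_z `|(EFin \o F) z| = 0)%E.
  have -> : (\int[(L \x P)%E]_z `|(EFin \o F) z| =
      (\int[(L \x P)%E]_z F z)%R%:E)%E.
    rewrite /Rintegral fineK ?integrable_fin_num//.
    by apply: eq_integral => z _; rewrite /= ger0_norm//; exact: ge0.
  congr EFin; apply/eqP; rewrite eq_le nonlinear_term_le0/=.
  by apply: Rintegral_ge0 => z _; exact: ge0.
have := (ae_eq_integral_abs _ measurableT mgb).1 F0.
by apply: filterS => z /(_ I) [].
Qed.

End energy_argument.

(** * Test functions *)

Section exponential_bump.
Context {R : realType}.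
Implicit Types (x y : R) (Q : {poly R}).

Lemma poly_expRN_bounded Q : exists2 C, 0 <= C &
  forall y, 0 <= y -> `|Q.[y]| * expR (- y) <= C.
Proof.
exists (\sum_(i < size Q) `|Q`_i| * i`!%:R).
  by apply: sumr_ge0 => i _; rewrite mulr_ge0.
move=> y y0; rewrite horner_coef.
rewrite (le_trans (ler_wpM2r (expR_ge0 _) (ler_norm_sum _ _ _)))// mulr_suml.
apply: ler_sum => i _; rewrite normrM -mulrA ler_wpM2l// normrX (ger0_norm y0).
rewrite expRN ler_pdivrMr ?expR_gt0//.
case: (nat_of_ord i) => [|n].
  by rewrite expr0 fact0 mul1r (le_trans _ (expR_ge1Dx y))// lerDl.
have := expR_ge1Dxn n y0; rewrite -(ler_pM2l (x := n.+1`!%:R)) ?ltr0n ?fact_gt0//.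
apply: le_trans; rewrite mulrDr mulr1 mulrCA divff ?mulr1 ?pnatr_eq0 -?lt0n ?fact_gt0//.
by rewrite lerDr.
Qed.

Fixpoint flat_poly (j : nat) : {poly R} :=
  if j is j'.+1 then 'X^2 * (flat_poly j' - (flat_poly j')^`()) else 1.

(** The j-th derivative of the flat function exp(-1/x), extended by zero to
    the left half line: a polynomial in 1/x times exp(-1/x). *)
Definition flat (j : nat) x : R :=
  if 0 < x then (flat_poly j).[x^-1] * expR (- x^-1) else 0.

(** The exponential beats every polynomial in 1/x; this flatness is what makes
    all the derivatives match at 0. *)
Lemma flat_quadratic j : exists2 C, 0 <= C & forall x, `|flat j x| <= C * x ^+ 2.
Proof.
have [C C0 hC] := poly_expRN_bounded ('X^2 * flat_poly j).
exists C => // x; rewrite /flat; case: ltP => [x0|_]; last first.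
  by rewrite normr0 mulr_ge0// sqr_ge0.
have xV0 : 0 <= x^-1 by rewrite invr_ge0 ltW.
rewrite normrM (ger0_norm (expR_ge0 _)).
have := hC _ xV0; rewrite hornerM hornerXn normrM normrX (ger0_norm xV0).
by rewrite -mulrA exprVn mulrC ler_pdivrMr ?exprn_gt0.
Qed.

Lemma is_derive_horner Q x : is_derive x (1 : R) (horner Q) Q^`().[x].
Proof.
by apply: DeriveDef; [exact: derivable_horner|rewrite derivE derive1E].
Qed.

Lemma is_derive_flat j x : is_derive x (1 : R) (flat j) (flat j.+1 x).
Proof.
have [x0|x0|x0] := ltgtP x 0.
- have -> : flat j.+1 x = 0 by rewrite /flat ltNge (ltW x0).
  apply: (near_eq_is_derive (f := cst 0)).
  apply: filterS (lt_nbhsl x0) => y y0.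
  by rewrite /flat ltNge (ltW y0).
- have -> : flat j.+1 x = (flat_poly j.+1).[x^-1] * expR (- x^-1).
    by rewrite /flat x0.
  have xn0 : x != 0 by rewrite gt_eqF.
  apply: (near_eq_is_derive (f := fun y => (flat_poly j).[y^-1] * expR (- y^-1))).
    by apply: filterS (lt_nbhsr x0) => y y0; rewrite /flat y0.
  have dV : is_derive x (1 : R) (fun y => y^-1) (- x ^- 2).
    apply: DeriveDef; first exact: derivableV.
    by rewrite deriveV// derive_id [LHS]mulr1.
  have dp := @is_derive1_comp _ (horner (flat_poly j)) (fun y => y^-1) x _ _
    (is_derive_horner (flat_poly j) x^-1) dV.
  have dN := is_deriveN dV.
  have de := @is_derive1_comp _ expR (fun y => - y^-1) x _ _
    (is_derive_expR (- x^-1)) dN.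
  have := is_deriveM dp de => dM; apply: (is_derive_eq dM).
  rewrite /GRing.scale/= hornerM hornerXn hornerD hornerN.
  by field.
rewrite x0 {x x0}; have -> : flat j.+1 0 = 0 by rewrite /flat ltxx.
have [C C0 hC] := flat_quadratic j.
have C1 : 0 < C + 1 by rewrite ltr_wpDl.
have f0 : flat j 0 = 0 by rewrite /flat ltxx.
have q0 : h^-1 *: (flat j (h *: 1 + 0) - flat j 0) @[h --> 0^'] --> (0 : R).
  apply/cvgrPdist_le => e e0; near=> h.
  rewrite sub0r normrN f0 subr0 addr0 [h *: 1]mulr1 normrM normfV.
  have h0 : h != 0 by near: h; exact: nbhs_dnbhs_neq.
  rewrite mulrC ler_pdivrMr ?normr_gt0// (le_trans (hC h))//.
  rewrite -real_normK ?num_real// expr2 mulrA ler_wpM2r//.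
  rewrite (@le_trans _ _ ((C + 1) * `|h|))//.
    by rewrite ler_wpM2r// lerDl.
  rewrite mulrC -ler_pdivlMr//.
  near: h; apply: nbhs_dnbhs; apply: filterS (nbhs0_le (divr_gt0 e0 C1)).
  by [].
apply: DeriveDef; first by apply/cvg_ex; exists 0.
exact: cvg_lim q0.
Unshelve. all: by end_near. Qed.

Lemma flat_continuous j : continuous (flat j).
Proof.
move=> x; apply: differentiable_continuous; apply/derivable1_diffP.
by case: (is_derive_flat j x).
Qed.

Lemma flat_eq0 j x : x <= 0 -> flat j x = 0.
Proof. by move=> x0; rewrite /flat ltNge x0. Qed.

(** The function exp(-1/(c+t) - 1/(c-t)) on (-c, c), extended by zero. Being
    strictly decreasing on (0, c), it turns the term - chi' (u1 - u2) of the
    equation for chi (u1 - u2) into a damping. *)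
Definition cutoff c t : R := flat 0 (c + t) * flat 0 (c - t).

Definition dcutoff c t : R :=
  flat 1 (c + t) * flat 0 (c - t) - flat 0 (c + t) * flat 1 (c - t).

Lemma is_derive_cutoff c t : is_derive t (1 : R) (cutoff c) (dcutoff c t).
Proof.
have d1 : is_derive t (1 : R) (fun s => c + s) 1.
  have d := is_deriveD (is_derive_cst c t (1 : R)) (is_derive_id t (1 : R)).
  by apply: (is_derive_eq d); rewrite add0r.
have d2 : is_derive t (1 : R) (fun s => c - s) (-1).
  have d := is_deriveB (is_derive_cst c t (1 : R)) (is_derive_id t (1 : R)).
  by apply: (is_derive_eq d); rewrite sub0r.
have e1 := @is_derive1_comp _ (flat 0) _ t _ _ (is_derive_flat 0 (c + t)) d1.
have e2 := @is_derive1_comp _ (flat 0) _ t _ _ (is_derive_flat 0 (c - t)) d2.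
have := is_deriveM e1 e2 => dM; apply: (is_derive_eq dM).
by rewrite /dcutoff /GRing.scale/=; ring.
Qed.

Lemma cutoff_out c t : ~~ (- c < t < c) -> cutoff c t = 0 /\ dcutoff c t = 0.
Proof.
rewrite negb_and -!leNgt => /orP[tc|ct].
  have c0 : c + t <= 0 by rewrite addrC -lerBrDr sub0r.
  by rewrite /cutoff /dcutoff !(flat_eq0 _ c0) !mul0r subrr.
have c0 : c - t <= 0 by rewrite subr_le0.
by rewrite /cutoff /dcutoff !(flat_eq0 _ c0) !mulr0 subrr.
Qed.

Lemma cutoff_gt0 c t : 0 < t < c -> 0 < cutoff c t.
Proof.
move=> /andP[t0 tc].
have c1 : 0 < c + t by rewrite addr_gt0// (lt_trans t0).
have c2 : 0 < c - t by rewrite subr_gt0.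
by rewrite /cutoff /flat c1 c2 /= !hornerC !mul1r mulr_gt0 ?expR_gt0.
Qed.

Lemma dcutoff_lt0 c t : 0 < t < c -> dcutoff c t < 0.
Proof.
move=> tc; have c0 := cutoff_gt0 tc; move: tc c0 => /andP[t0 tc].
have c1 : 0 < c + t by rewrite addr_gt0// (lt_trans t0).
have c2 : 0 < c - t by rewrite subr_gt0.
have flat1 x : 0 < x -> flat 1 x = x ^- 2 * flat 0 x.
  move=> x0; rewrite /flat x0 /= hornerM hornerXn derivC subr0 exprVn.
  by rewrite mulrA.
move=> c0; rewrite /dcutoff !flat1//.
have -> : (c + t) ^- 2 * flat 0 (c + t) * flat 0 (c - t) -
    flat 0 (c + t) * ((c - t) ^- 2 * flat 0 (c - t)) =
    ((c + t) ^- 2 - (c - t) ^- 2) * cutoff c t by rewrite /cutoff; ring.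
rewrite pmulr_llt0// subr_lt0 ltf_pV2 ?posrE ?exprn_gt0//.
by rewrite ltr_pXn2r// ?nnegrE ?ltW//; lra.
Qed.

Lemma flat_bounded j : exists2 C, 0 <= C & forall x, `|flat j x| <= C.
Proof.
have [C C0 hC] := poly_expRN_bounded (flat_poly j).
exists C => // x; rewrite /flat; case: ltP => [x0|_]; last by rewrite normr0.
by rewrite normrM (ger0_norm (expR_ge0 _)) hC// invr_ge0 ltW.
Qed.

Lemma cutoff_bounded c : exists C, forall t, `|cutoff c t| <= C.
Proof.
have [C C0 hC] := flat_bounded 0; exists (C * C) => t.
by rewrite /cutoff normrM ler_pM.
Qed.

Lemma dcutoff_bounded c : exists C, forall t, `|dcutoff c t| <= C.
Proof.
have [C C0 hC] := flat_bounded 0; have [D D0 hD] := flat_bounded 1.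
exists (D * C + C * D) => t; rewrite /dcutoff.
by rewrite (le_trans (ler_normB _ _))// lerD// normrM ler_pM.
Qed.

Lemma measurable_flat j : measurable_fun setT (flat j).
Proof. by apply: continuous_measurable_fun; exact: flat_continuous. Qed.

Lemma measurable_cutoff c : measurable_fun setT (cutoff c).
Proof.
by apply: measurable_funM; apply: (measurableT_comp (measurable_flat 0));
  [exact: measurable_funD|exact: measurable_funB].
Qed.

Lemma measurable_dcutoff c : measurable_fun setT (dcutoff c).
Proof.
have mD : measurable_fun setT (fun t : R => c + t) by exact: measurable_funD.
have mB : measurable_fun setT (fun t : R => c - t) by exact: measurable_funB.
by apply: measurable_funB; apply: measurable_funM;
  do ?[exact: (measurableT_comp (measurable_flat _) mD)
      |exact: (measurableT_comp (measurable_flat _) mB)].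
Qed.

End exponential_bump.

Section smooth_closure.
Context {R : realType} {V : normedModType R}.
Implicit Types f g : V -> R.

Lemma CkW k f : Ck k.+1 f -> Ck k f.
Proof.
elim: k f => [|k IHk] f [df Df] /=; first by move=> z; exact: differentiable_continuous.
by split=> // v; exact: IHk.
Qed.

Lemma CkD k f g : Ck k f -> Ck k g -> Ck k (fun z => f z + g z).
Proof.
elim: k f g => [|k IHk] f g /=.
  by move=> cf cg z; apply: cvgD; [exact: cf|exact: cg].
move=> [df Df] [dg Dg]; split=> [z|v].
  exact: (differentiableD (df z) (dg z)).
rewrite [X in Ck k X](_ : _ = fun z => 'D_v f z + 'D_v g z).
  by apply: IHk; [exact: Df|exact: Dg].
apply/funext => z; apply: deriveD; exact: diff_derivable.
Qed.

Lemma CkM k f g : Ck k f -> Ck k g -> Ck k (fun z => f z * g z).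
Proof.
elim: k f g => [|k IHk] f g.
  by move=> cf cg z; apply: cvgM; [exact: cf|exact: cg].
move=> Cf Cg; have [Cf' Cg'] := (CkW Cf, CkW Cg).
move: Cf Cg => [df Df] [dg Dg]; split=> [z|v].
  exact: (differentiableM (df z) (dg z)).
rewrite [X in Ck k X](_ : _ = fun z => f z * 'D_v g z + g z * 'D_v f z).
  by apply: CkD; apply: IHk => //; [exact: Dg|exact: Df].
by apply/funext => z; apply: deriveM; exact: diff_derivable.
Qed.

Lemma Ck_cst k (a : R) : Ck k (fun _ : V => a).
Proof.
elim: k a => [|k IHk] a /=; first by move=> z; exact: cvg_cst.
split=> [z|v]; first exact: differentiable_cst.
rewrite [X in Ck k X](_ : _ = fun=> 0)//.
by apply/funext => z; exact: derive_cst.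
Qed.

Lemma Ck_prod k (I : Type) (r : seq I) (F : I -> V -> R) :
  (forall i, Ck k (F i)) -> Ck k (fun z => \prod_(i <- r) F i z).
Proof.
move=> CF; elim: r => [|i r IHr].
  by under eq_fun do rewrite big_nil; exact: Ck_cst.
by under eq_fun do rewrite big_cons; exact: CkM.
Qed.

(** By the chain rule, a directional derivative stays within the family
    G j o l up to a constant factor, so that induction on k applies. *)
Lemma Ck_comp k (G : nat -> R -> R) (l : V -> R) (dl : V -> R) :
  (forall j x, is_derive x (1 : R) (G j) (G j.+1 x)) ->
  (forall z, differentiable l z) -> (forall v z, 'D_v l z = dl v) ->
  forall j, Ck k (fun z => G j (l z)).
Proof.
move=> dG dfl Dl; elim: k => [|k IHk] j.
  move=> z; apply: continuous_comp; first exact: differentiable_continuous.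
  by apply: differentiable_continuous; apply/derivable1_diffP; case: (dG j (l z)).
have dGj x : differentiable (G j) x by apply/derivable1_diffP; case: (dG j x).
split=> [z|v]; first exact: differentiable_comp.
rewrite [X in Ck k X](_ : _ = fun z => dl v * G j.+1 (l z)).
  by apply: CkM; [exact: Ck_cst|exact: IHk].
apply/funext => z; rewrite deriveE; last exact: differentiable_comp.
rewrite diff_comp//= diff1E// -deriveE// Dl.
by have [_ Gv] := dG j (l z); rewrite derive1E Gv.
Qed.

(** Reduces the partial derivatives of test functions to calculus in one variable. *)
Lemma derive_line f (phi : R -> R) (z v : V) (a : R) :
  (forall h : R, f (h *: v + z) = phi h) -> is_derive 0 (1 : R) phi a ->
  'D_v f z = a.
Proof.
move=> fphi [_ phia]; rewrite -phia /derive.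
have E : (fun h : R => h^-1 *: ((f \o shift z) (h *: v) - f z)) =
    (fun h : R => h^-1 *: ((phi \o shift 0) (h *: 1) - phi 0)).
  apply/funext => h /=; rewrite fphi [h *: 1]mulr1 addr0.
  by have := fphi 0; rewrite scale0r add0r => ->.
by rewrite E.
Qed.

End smooth_closure.

Section test_functions.
Context {R : realType} (d : nat).
Notation V := (R * 'rV[R]_d)%type.
Implicit Types (z : V) (x : Rpt R d).

(** The kernel tker centred at x, lifted to R x R^d with a time factor. *)
Definition tensor_fun N (J : 'I_d -> nat) x (chi : R -> R) z : R :=
  chi z.1 * \prod_(i < d) fejerd N (J i) (tnth x i - z.2 ord0 i).

Lemma tensor_funE N J x chi s (y : Rpt R d) :
  tensor_fun N J x chi (s, row_of_pt y) = chi s * tker N J x y.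
Proof.
by congr (_ * _); apply: eq_bigr => i _; rewrite /row_of_pt mxE.
Qed.

Lemma fst_differentiable z : differentiable (fun z : V => z.1) z.
Proof.
apply: (@linear_differentiable _ _ _ (GRing.Linear.clone _ _ _ _ (fst : V -> R) _)) => w.
exact: cvg_fst.
Qed.

Lemma coord_differentiable i z : differentiable (fun z : V => z.2 ord0 i) z.
Proof.
apply: (@differentiable_comp _ _ _ _ (snd : V -> 'rV[R]_d)
  (fun M : 'rV[R]_d => M ord0 i)).
  apply: (@linear_differentiable _ _ _ (GRing.Linear.clone _ _ _ _ (snd : V -> _) _)) => w.
  exact: cvg_snd.
exact: differentiable_coord.
Qed.

Lemma derive_fst (v z : V) : 'D_v (fun z : V => z.1) z = v.1.
Proof.
apply: (derive_line (phi := fun h => h * v.1 + z.1)) => //.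
have d1 := is_deriveM (is_derive_id (0 : R) (1 : R)) (is_derive_cst v.1 (0 : R) (1 : R)).
have d2 := is_deriveD d1 (is_derive_cst z.1 (0 : R) (1 : R)).
by apply: (is_derive_eq d2); rewrite /GRing.scale/= mul0r add0r mulr1 addr0.
Qed.

Lemma derive_coord i (v z : V) : 'D_v (fun z : V => z.2 ord0 i) z = v.2 ord0 i.
Proof.
apply: (derive_line (phi := fun h => h * v.2 ord0 i + z.2 ord0 i)) => [h|].
  by rewrite /= !mxE.
have d1 := is_deriveM (is_derive_id (0 : R) (1 : R))
  (is_derive_cst (v.2 ord0 i) (0 : R) (1 : R)).
have d2 := is_deriveD d1 (is_derive_cst (z.2 ord0 i) (0 : R) (1 : R)).
by apply: (is_derive_eq d2); rewrite /GRing.scale/= mul0r add0r mulr1 addr0.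
Qed.

Lemma is_derive_fejer_shift N j (a b : R) :
  is_derive b (1 : R) (fun b => fejerd N j (a - b)) (- fejerd N j.+1 (a - b)).
Proof.
have d1 : is_derive b (1 : R) (fun b => a - b) (- 1).
  apply: (is_derive_eq (is_deriveB (is_derive_cst a b (1 : R)) (is_derive_id b (1 : R)))).
  by rewrite sub0r.
have d2 := @is_derive1_comp _ (fejerd N j) (fun b => a - b) b _ _
  (is_derive_fejerd N j (a - b)) d1.
by apply: (is_derive_eq d2); rewrite mulrN1.
Qed.

Lemma smooth_tensor_fun N x (c : R) :
  smooth (tensor_fun N (fun=> 0%N) x (cutoff c)).
Proof.
move=> k; apply: CkM.
  have d1 j b : is_derive b (1 : R) (fun t => flat j (c + t)) (flat j.+1 (c + b)).
    have d1 : is_derive b (1 : R) (fun t => c + t) 1.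
      apply: (is_derive_eq (is_deriveD (is_derive_cst c b (1 : R)) (is_derive_id b (1 : R)))).
      by rewrite add0r.
    have d2 := @is_derive1_comp _ (flat j) _ b _ _ (is_derive_flat j (c + b)) d1.
    by apply: (is_derive_eq d2); rewrite mulr1.
  have d2 j b : is_derive b (1 : R) (fun t => (-1) ^+ j * flat j (c - t))
      ((-1) ^+ j.+1 * flat j.+1 (c - b)).
    have d2 : is_derive b (1 : R) (fun t => c - t) (- 1).
      apply: (is_derive_eq (is_deriveB (is_derive_cst c b (1 : R)) (is_derive_id b (1 : R)))).
      by rewrite sub0r.
    have d3 := @is_derive1_comp _ (flat j) _ b _ _ (is_derive_flat j (c - b)) d2.
    apply: (is_derive_eq (is_deriveZ ((-1) ^+ j) d3)).
    by rewrite /GRing.scale/= exprSr; ring.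
  apply: CkM.
    exact: (@Ck_comp _ _ k (fun j t => flat j (c + t)) _ (fun v : V => v.1) d1
      fst_differentiable derive_fst 0%N).
  have := @Ck_comp _ _ k (fun j t => (-1) ^+ j * flat j (c - t)) _
    (fun v : V => v.1) d2 fst_differentiable derive_fst 0%N.
  by under eq_fun do rewrite expr0 mul1r.
apply: Ck_prod => i.
pose G j (b : R) := (-1) ^+ j * fejerd N j (tnth x i - b).
have dG j b : is_derive b (1 : R) (G j) (G j.+1 b).
  have d1 := is_deriveZ ((-1) ^+ j) (is_derive_fejer_shift N j (tnth x i) b).
  by apply: (is_derive_eq d1); rewrite /G /GRing.scale/= exprSr; ring.
have := @Ck_comp _ _ k G _ (fun v : V => v.2 ord0 i) dG (coord_differentiable i)
  (fun v z => derive_coord i v z) 0%N.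
by rewrite /G; under eq_fun do rewrite expr0 mul1r.
Qed.

Lemma test_function_tensor N x (c T : R) : c < T ->
  test_function T (tensor_fun N (fun=> 0%N) x (cutoff c)).
Proof.
move=> cT; split.
- exact: smooth_tensor_fun.
- move=> t y i; congr (_ * _); apply: eq_bigr => l _; rewrite !mxE /=.
  case: (l == i) => /=; last by rewrite addr0.
  rewrite -(fejerd_periodic N 0 (tnth x l - (y ord0 l + 1))).
  by congr (fejerd _ _ _); ring.
- exists (- c), c; split=> // t y; rewrite /tensor_fun /=.
  have [/andP[ct tc] _|tc] := boolP (- c < t < c); first by rewrite !ltW.
  by rewrite (cutoff_out tc).1 mul0r eqxx.
Qed.

Lemma dtime_tensor_fun N x (c : R) z :
  dtime (tensor_fun N (fun=> 0%N) x (cutoff c)) z =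
  tensor_fun N (fun=> 0%N) x (dcutoff c) z.
Proof.
pose p := \prod_(i < d) fejerd N 0 (tnth x i - z.2 ord0 i).
apply: (derive_line (phi := fun h => cutoff c (h + z.1) * p)) => [h|].
  rewrite /tensor_fun /= [h *: 1]mulr1; congr (_ * _).
  by apply: eq_bigr => i _; rewrite scaler0 add0r.
have d1 : is_derive (0 : R) (1 : R) (fun h => h + z.1) 1.
  apply: (is_derive_eq (is_deriveD (is_derive_id (0 : R) (1 : R))
    (is_derive_cst z.1 (0 : R) (1 : R)))).
  by rewrite addr0.
have d2 := @is_derive1_comp _ (cutoff c) (fun h => h + z.1) 0 _ _
  (is_derive_cutoff c (0 + z.1)) d1.
have d3 := is_deriveM d2 (is_derive_cst p (0 : R) (1 : R)).
apply: (is_derive_eq d3).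
by rewrite /GRing.scale/= /tensor_fun -/p add0r; ring.
Qed.

Lemma dspace_tensor_fun N x (chi : R -> R) (a : R) (i : 'I_d) j z :
  dspace i (fun z => a * tensor_fun N (order_at i j) x chi z) z =
  - a * tensor_fun N (order_at i j.+1) x chi z.
Proof.
pose p := \prod_(l < d | l != i) fejerd N 0 (tnth x l - z.2 ord0 l).
have split_i k w : tensor_fun N (order_at i k) x chi w = chi w.1 *
    (fejerd N k (tnth x i - w.2 ord0 i) *
     \prod_(l < d | l != i) fejerd N 0 (tnth x l - w.2 ord0 l)).
  rewrite /tensor_fun (bigD1 i)//= /order_at eqxx; congr (_ * (_ * _)).
  by apply: eq_bigr => l /negbTE ->.
apply: (derive_line (phi := fun h =>
  a * chi z.1 * p * fejerd N j (tnth x i - (h + z.2 ord0 i)))) => [h|].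
  rewrite split_i /= scaler0 add0r !mxE !eqxx mulr1.
  rewrite (eq_bigr (fun l => fejerd N 0 (tnth x l - z.2 ord0 l))); last first.
    by move=> l /negbTE li; rewrite !mxE li andbF mulr0 add0r.
  by rewrite -/p; ring.
have d1 : is_derive (0 : R) (1 : R) (fun h => h + z.2 ord0 i) 1.
  apply: (is_derive_eq (is_deriveD (is_derive_id (0 : R) (1 : R))
    (is_derive_cst (z.2 ord0 i) (0 : R) (1 : R)))).
  by rewrite addr0.
have d2 := @is_derive1_comp _ (fun b => fejerd N j (tnth x i - b))
  (fun h => h + z.2 ord0 i) 0 _ _
  (is_derive_fejer_shift N j (tnth x i) (0 + z.2 ord0 i)) d1.
apply: (is_derive_eq (is_deriveZ (a * chi z.1 * p) d2)).
by rewrite split_i -/p /GRing.scale/= add0r; ring.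
Qed.

Lemma laplacian_tensor_fun N x (chi : R -> R) s (y : Rpt R d) :
  laplacian (tensor_fun N (fun=> 0%N) x chi) (s, row_of_pt y) =
  chi s * laplace_ker N x y.
Proof.
rewrite /laplacian /laplace_ker mulr_sumr; apply: eq_bigr => i _.
have E0 : tensor_fun N (fun=> 0%N) x chi =
    (fun z => 1 * tensor_fun N (order_at i 0) x chi z).
  by apply/funext => z; rewrite mul1r order_at0.
rewrite E0 [X in dspace i X](_ : _ =
    (fun z => - 1 * tensor_fun N (order_at i 1) x chi z)).
  by rewrite dspace_tensor_fun opprK mul1r tensor_funE.
by apply/funext => z; exact: dspace_tensor_fun.
Qed.

End test_functions.

(** * Uniqueness of weak solutions *)

Lemma odd_power_monotone {R : realDomainType} (n : nat) (a b : R) : odd n ->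
  0 <= (a - b) * (a ^+ n - b ^+ n).
Proof.
move=> on; wlog ba : a b / b <= a.
  move=> H; have [/H//|ab] := leP b a.
  by rewrite -mulrNN !opprB; apply: H; exact: ltW.
rewrite mulr_ge0 ?subr_ge0//.
have [b0|b0] := leP 0 b; first by rewrite lerXn2r// ?nnegrE// (le_trans b0).
have [a0|a0] := leP 0 a.
  by rewrite (le_trans (y := 0)) ?exprn_ge0// exprn_odd_le0// ltW.
have E (x : R) : x ^+ n = - (- x) ^+ n.
  by rewrite exprNn -signr_odd on expr1 mulN1r opprK.
rewrite (E a) (E b) lerN2 lerXn2r ?nnegrE ?oppr_ge0 ?lerN2//; exact: ltW.
Qed.

Section truncation.
Context {R : realType} (d : nat).
Notation L := (@lebesgue_measure R).
Notation P := (torus_measure R d).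
Notation X := (Rpt R d).
Variables (n : nat) (T : R) (u : measurableTypeR R -> X -> R).
Hypotheses (n0 : (0 < n)%N) (Lu : in_LnLn n u).

(** Measurability of a weak solution is only imposed at positive times, and its
    integrability follows from that of its n-th power only over bounded time
    intervals; hence the extension by zero outside (0, T). *)
Definition trunc (z : measurableTypeR R * X) : R :=
  if 0 < z.1 < T then u z.1 z.2 else 0.

Let win := [set z : measurableTypeR R * X | 0 < z.1 < T].

Let mwin : measurable win.
Proof.
have -> : win = fst @^-1` `]0, T[.
  by apply/seteqP; split => z; rewrite /= in_itv.
by rewrite -[X in measurable X]setTI; apply: measurable_fst.
Qed.

Let mhalf : measurable [set z : measurableTypeR R * X | 0 < z.1].
Proof.
have -> : [set z : measurableTypeR R * X | 0 < z.1] = fst @^-1` `]0, +oo[.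
  by apply/seteqP; split => z; rewrite /= in_itv/= andbT.
by rewrite -[X in measurable X]setTI; apply: measurable_fst.
Qed.

Lemma measurable_trunc : measurable_fun setT trunc.
Proof.
have -> : trunc = (fun z => u z.1 z.2) \_ win.
  apply/funext => z; rewrite patchE /trunc; case: ifPn => zT.
    by rewrite mem_set.
  by rewrite memNset//; exact/negP.
apply/(measurable_restrictT _ _).1 => //.
case: Lu => mu _; apply: measurable_funS mu; first exact: mhalf.
by move=> z /andP[].
Qed.

Lemma L1_truncX : L1 (L \x P)%E (fun z => trunc z ^+ n).
Proof.
pose v (z : measurableTypeR R * X) := if 0 < z.1 then u z.1 z.2 else 0.
have mv : measurable_fun setT v.
  have -> : v = (fun z => u z.1 z.2) \_ [set z | 0 < z.1].
    apply/funext => z; rewrite patchE /v; case: ifPn => zT.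
      by rewrite mem_set.
    by rewrite memNset//; exact/negP.
  by apply/(measurable_restrictT _ _).1; [exact: mhalf|case: Lu].
have mvn : measurable_fun setT (fun z => v z ^+ n) by exact: measurable_funX.
apply: (@le_L1 _ _ _ _ _ (fun z => `|v z ^+ n|)).
- by apply: measurable_funX; exact: measurable_trunc.
- move=> z; rewrite /trunc /v; case: (0 < z.1) => //=.
  by case: (z.1 < T) => //; rewrite expr0n gtn_eqF// normr0.
apply: L1_norm; apply: (@L1_prodI _ _ _ _ _ L P) => //.
apply: le_lt_trans Lu.2; rewrite [leRHS]integral_mkcond le_eqVlt.
apply/orP; left; apply/eqP; apply: eq_integral => s _; rewrite patchE /v.
case: ifPn; rewrite ?inE ?notin_setE/= in_itv/= andbT => s0.
  rewrite poweR_Lnorm ?pnatr_eq0 -?lt0n//; apply: eq_integral => x _.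
  by rewrite s0 /= powR_mulrn// normrX.
move/negP/negbTE: s0 => ->.
by apply: integral0_eq => x _; rewrite expr0n gtn_eqF// normr0.
Qed.

Lemma trunc_norm_le z : `|trunc z| <= `|trunc z ^+ n| + \1_win z.
Proof.
rewrite /trunc indicE; case: ifPn => [zT|_]; last by rewrite normr0 addr_ge0.
rewrite mem_set// normrX /=; set a := `|_|.
have [a1|a1] := leP a 1; first by rewrite (le_trans a1)// lerDr exprn_ge0 ?normr_ge0.
by rewrite (@le_trans _ _ (a ^+ n))// ?lerDl// ler_eXnr// ltW.
Qed.

(** On a bounded time window |u| <= |u|^n + 1 is integrable. *)
Lemma L1_trunc : 0 < T -> L1 (L \x P)%E trunc.
Proof.
move=> T0; apply: (le_L1 measurable_trunc trunc_norm_le).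
apply: L1D; first exact: L1_norm L1_truncX.
apply/integrableP; split; first exact/measurable_EFinP.
rewrite (eq_integral (fun z => (\1_win z)%:E)); last first.
  by move=> z _; rewrite gee0_abs// lee_fin.
rewrite integral_indic// setIT.
have -> : win = `]0, T[%classic `*` setT.
  by apply/seteqP; split => z; rewrite /= in_itv/=; [|case].
rewrite [X in (X < _)%E](product_measure1E L P (measurable_itv `]0, T[)
  measurableT).
rewrite [X in (_ * X)%E]probability_setT mule1.
rewrite [X in (X < _)%E](lebesgue_measure_itv `]0, T[).
by rewrite /= lte_fin T0 -EFinB ltry.
Qed.

End truncation.

Section difference.
Context {R : realType} (d : nat).
Notation L := (@lebesgue_measure R).
Notation P := (torus_measure R d).
Notation X := (Rpt R d).

Lemma Rintegral_itv_slices (F : measurableTypeR R * X -> R) (t : R) :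
  L1 (L \x P)%E F ->
  \int[L]_(s in `]0, t[) \int[P]_y F (s, y) =
  \int[(L \x P)%E]_z (F z * \1_(`]0, t[%classic) z.1).
Proof.
move=> IF.
have IF1 : L1 (L \x P)%E (fun z => F z * \1_(`]0, t[%classic) z.1).
  apply: (L1_bddM (C := 1)) => //.
  - apply: measurableT_comp => //; exact: measurable_indic.
  - by move=> z; rewrite indicE; case: (_ \in _); rewrite ?normr1 ?normr0.
rewrite -(Rfubini1 IF1) Rintegral_mkcond; apply: eq_Rintegral => s _.
rewrite patchE /= indicE; case: ifPn => st.
  by apply: eq_Rintegral => y _; rewrite mulr1.
by under [RHS]eq_Rintegral do rewrite mulr0; rewrite Rintegral_cst// mul0r.
Qed.

Lemma Rintegral_itv_slicesB (F G : measurableTypeR R * X -> R) (t : R) :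
  L1 (L \x P)%E F -> L1 (L \x P)%E G ->
  \int[L]_(s in `]0, t[) \int[P]_y (F (s, y) - G (s, y)) =
  \int[L]_(s in `]0, t[) (\int[P]_y F (s, y)) -
  \int[L]_(s in `]0, t[) (\int[P]_y G (s, y)).
Proof.
move=> IF IG.
rewrite (Rintegral_itv_slices t (L1B IF IG)).
rewrite (Rintegral_itv_slices t IF) (Rintegral_itv_slices t IG).
have I1 (H : measurableTypeR R * X -> R) : L1 (L \x P)%E H ->
    L1 (L \x P)%E (fun z => H z * \1_(`]0, t[%classic) z.1).
  move=> IH; apply: (L1_bddM (C := 1)) => //.
  - apply: measurableT_comp => //; exact: measurable_indic.
  - by move=> z; rewrite indicE; case: (_ \in _); rewrite ?normr1 ?normr0.
rewrite -(RintegralB measurableT (I1 _ IF) (I1 _ IG)).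
by apply: eq_Rintegral => z _; rewrite mulrBl.
Qed.

Section one_solution.
Variables (n : nat) (c T : R) (uin : X -> R) (u : measurableTypeR R -> X -> R).
Hypotheses (n0 : (0 < n)%N) (c0 : 0 < c) (cT : c < T).
Hypothesis wu : weak_solution n uin u.

Let U := trunc T u.

(** The integrand in the weak formulation for the test function given by the
    cutoff times the kernel centred at x. *)
Definition flux N (x : X) (z : measurableTypeR R * X) : R :=
  (trunc T u z * dcutoff c z.1 - trunc T u z ^+ n * cutoff c z.1)
    * tker N (fun=> 0%N) x z.2
  + trunc T u z * cutoff c z.1 * laplace_ker N x z.2.

Let IU : L1 (L \x P)%E U.
Proof. by apply: L1_trunc wu.1 _ => //; exact: lt_trans cT. Qed.

Let IUn : L1 (L \x P)%E (fun z => U z ^+ n).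
Proof. exact: L1_truncX n0 wu.1. Qed.

Lemma L1_timeM (F : measurableTypeR R * X -> R) (chi : R -> R) :
  L1 (L \x P)%E F -> measurable_fun setT chi ->
  (exists C, forall t, `|chi t| <= C) -> L1 (L \x P)%E (fun z => F z * chi z.1).
Proof.
move=> IF mchi [C hC]; apply: (L1_bddM (C := C)) => //.
exact: (measurableT_comp mchi measurable_fst).
Qed.

Lemma L1_spaceM (F : measurableTypeR R * X -> R) (k : X -> X -> R) x :
  L1 (L \x P)%E F -> measurable_fun setT (fun z : X * X => k z.1 z.2) ->
  (exists C, forall x y, `|k x y| <= C) -> L1 (L \x P)%E (fun z => F z * k x z.2).
Proof.
move=> IF mk [C hC]; apply: (L1_bddM (C := C)) => //.
exact: (measurableT_comp (measurable_kernelr mk x) measurable_snd).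
Qed.

Let IUd := L1_timeM IU (measurable_dcutoff c) (dcutoff_bounded c).
Let IUc := L1_timeM IU (measurable_cutoff c) (cutoff_bounded c).
Let IUnc := L1_timeM IUn (measurable_cutoff c) (cutoff_bounded c).

Lemma L1_flux N x : L1 (L \x P)%E (flux N x).
Proof.
apply: L1D.
  by apply: L1_spaceM; [exact: L1B|exact: measurable_tker|exact: tker_bounded].
apply: L1_spaceM => //; [exact: measurable_laplace_ker|exact: laplace_ker_bounded].
Qed.

Lemma weak_flux N x :
  {ae L, forall t : measurableTypeR R, 0 < t < T ->
    \int[P]_y (trunc T u (t, y) * cutoff c t * tker N (fun=> 0%N) x y) =
    \int[P]_y (uin y * (cutoff c 0 * tker N (fun=> 0%N) x y)) +
    \int[L]_(s in `]0, t[) \int[P]_y flux N x (s, y)}.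
Proof.
pose psi := tensor_fun N (fun=> 0%N) x (cutoff c).
have T0 : 0 < T by exact: lt_trans cT.
apply: filterS (wu.2 T T0 psi (test_function_tensor N x cT)) => t wt t0T.
have /wt {wt} : t \in `]0, T[ by rewrite in_itv.
have tr (s : R) (y : X) : 0 < s < T -> U (s, y) = u s y.
  by move=> sT; rewrite /U /trunc sT.
have sT (s : R) : s \in `]0, t[%classic -> 0 < s < T.
  rewrite inE/= in_itv/= => /andP[-> st]/=; apply: lt_trans st _.
  by case/andP: t0T.
have psiE (s : R) (y : X) :
    psi (s, row_of_pt y) = cutoff c s * tker N (fun=> 0%N) x y.
  exact: tensor_funE.
have dpsiE (s : R) (y : X) :
    dtime psi (s, row_of_pt y) = dcutoff c s * tker N (fun=> 0%N) x y.
  by rewrite /psi dtime_tensor_fun tensor_funE.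
have lpsiE (s : R) (y : X) :
    laplacian psi (s, row_of_pt y) = cutoff c s * laplace_ker N x y.
  exact: laplacian_tensor_fun.
pose FA z := U z * dcutoff c z.1 * tker N (fun=> 0%N) x z.2.
pose FB z := U z ^+ n * cutoff c z.1 * tker N (fun=> 0%N) x z.2.
pose FC z := U z * cutoff c z.1 * laplace_ker N x z.2.
have IFA : L1 (L \x P)%E FA.
  by apply: L1_spaceM => //; [exact: measurable_tker|exact: tker_bounded].
have IFB : L1 (L \x P)%E FB.
  by apply: L1_spaceM => //; [exact: measurable_tker|exact: tker_bounded].
have IFC : L1 (L \x P)%E FC.
  by apply: L1_spaceM => //; [exact: measurable_laplace_ker|exact: laplace_ker_bounded].
have EA : \int[L]_(s in `]0, t[) \int[P]_y (u s y * dtime psi (s, row_of_pt y)) =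
    \int[L]_(s in `]0, t[) \int[P]_y FA (s, y).
  apply: eq_Rintegral => s /sT s0; apply: eq_Rintegral => y _.
  by rewrite dpsiE /FA (tr _ _ s0) mulrA.
have EB : \int[L]_(s in `]0, t[) \int[P]_y (u s y ^+ n * psi (s, row_of_pt y)) =
    \int[L]_(s in `]0, t[) \int[P]_y FB (s, y).
  apply: eq_Rintegral => s /sT s0; apply: eq_Rintegral => y _.
  by rewrite psiE /FB (tr _ _ s0) mulrA.
have EC : \int[L]_(s in `]0, t[) \int[P]_y
      (u s y * laplacian psi (s, row_of_pt y)) =
    \int[L]_(s in `]0, t[) \int[P]_y FC (s, y).
  apply: eq_Rintegral => s /sT s0; apply: eq_Rintegral => y _.
  by rewrite lpsiE /FC (tr _ _ s0) mulrA.
have E1 : \int[P]_y (u t y * psi (t, row_of_pt y)) =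
    \int[P]_y (U (t, y) * cutoff c t * tker N (fun=> 0%N) x y).
  by apply: eq_Rintegral => y _; rewrite psiE (tr _ _ t0T) mulrA.
have EF : \int[L]_(s in `]0, t[) \int[P]_y flux N x (s, y) =
    \int[L]_(s in `]0, t[) (\int[P]_y FA (s, y)) -
    (\int[L]_(s in `]0, t[) (\int[P]_y FB (s, y)) -
     \int[L]_(s in `]0, t[) (\int[P]_y FC (s, y))).
  apply: etrans (congr1 (fun r => \int[L]_(s in `]0, t[) (\int[P]_y FA (s, y)) - r)
    (Rintegral_itv_slicesB t IFB IFC)).
  apply: etrans (Rintegral_itv_slicesB t IFA (L1B IFB IFC)).
  apply: eq_Rintegral => s _; apply: eq_Rintegral => y _.
  by rewrite /flux /FA /FB /FC /U /=; ring.
have E0 : \int[P]_y (uin y * psi (0, row_of_pt y)) =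
    \int[P]_y (uin y * (cutoff c 0 * tker N (fun=> 0%N) x y)).
  by apply: eq_Rintegral => y _; rewrite psiE.
have alg (a b e f h : R) : a - b - e + f = h -> a = b + (e - (f - h)).
  by move=> <-; ring.
by rewrite EA EB EC E1 E0 EF; exact: alg.
Qed.

End one_solution.

(** Here g beta(W) is chi / jap(W) times the sum of the nonnegative terms
    chi (u1 - u2) (u1^n - u2^n) and - chi' (u1 - u2)^2. It vanishes almost
    everywhere by nonlinear_term_ae0, and the second term, in which chi' < 0,
    vanishes only where u1 = u2. *)
Lemma uniqueness_window (n : nat) (c : R) (uin : X -> R)
    (u1 u2 : measurableTypeR R -> X -> R) :
  odd n -> 0 < c -> weak_solution n uin u1 -> weak_solution n uin u2 ->
  {ae (L \x P)%E, forall z : measurableTypeR R * X,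
    0 < z.1 < c -> u1 z.1 z.2 = u2 z.1 z.2}.
Proof.
move=> on c0 w1 w2; have n0 : (0 < n)%N by case: n on {w1 w2}.
pose T := c + 1; have cT : c < T by rewrite ltrDl.
have T0 : 0 < T by exact: lt_trans cT.
pose U1 := trunc T u1; pose U2 := trunc T u2.
pose W z := (U1 z - U2 z) * cutoff c z.1.
pose g z := (U1 z ^+ n - U2 z ^+ n) * cutoff c z.1 - (U1 z - U2 z) * dcutoff c z.1.
have IU1 : L1 (L \x P)%E U1 by exact: L1_trunc n0 w1.1 T0.
have IU2 : L1 (L \x P)%E U2 by exact: L1_trunc n0 w2.1 T0.
have IUn1 : L1 (L \x P)%E (fun z => U1 z ^+ n) by exact: L1_truncX n0 w1.1.
have IUn2 : L1 (L \x P)%E (fun z => U2 z ^+ n) by exact: L1_truncX n0 w2.1.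
have mc := measurable_cutoff c; have bc := cutoff_bounded c.
have md := measurable_dcutoff c; have bd := dcutoff_bounded c.
have IW : L1 (L \x P)%E W by exact: L1_timeM (L1B IU1 IU2) mc bc.
have Ig : L1 (L \x P)%E g.
  apply: L1B; first exact: L1_timeM (L1B IUn1 IUn2) mc bc.
  exact: L1_timeM (L1B IU1 IU2) md bd.
have out (s : R) : ~~ (0 < s < c) -> (forall y, W (s, y) = 0) /\ (forall y, g (s, y) = 0).
  rewrite negb_and => /orP[s0|sc].
    have t0 u y : trunc T u (s, y) = 0 by rewrite /trunc /= (negbTE s0).
    by split=> y; rewrite /W /g /U1 /U2 !t0 ?subrr !mul0r ?subrr.
  have [k0 d0] : cutoff c s = 0 /\ dcutoff c s = 0.
    by apply: cutoff_out; rewrite negb_and sc orbT.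
  by split=> y; rewrite /W /g /= k0 ?d0 !mulr0 ?subrr.
have weak N x : {ae L, forall t : measurableTypeR R, 0 < t < T ->
    \int[P]_y (W (t, y) * tker N (fun=> 0%N) x y) =
    \int[L]_(s in `]0, t[) \int[P]_y
      (W (s, y) * laplace_ker N x y - g (s, y) * tker N (fun=> 0%N) x y)}.
  have ae1 : {ae L, forall t, L1 P (fun y => U1 (t, y))} := ae_integrable1 IU1.
  have ae2 : {ae L, forall t, L1 P (fun y => U2 (t, y))} := ae_integrable1 IU2.
  have aeU : {ae L, forall t,
      L1 P (fun y => U1 (t, y)) /\ L1 P (fun y => U2 (t, y))}.
    by apply: filterS2 ae1 ae2.
  apply: filterS3 aeU (weak_flux n0 c0 cT w1 N x) (weak_flux n0 c0 cT w2 N x).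
  move=> t [It1 It2] F1 F2 tT.
  have [C hC] := @tker_bounded R d N (fun=> 0%N).
  have mk := @measurable_tker R d N (fun=> 0%N).
  have Ik (u : X -> R) : L1 P u -> L1 P (fun y => u y * cutoff c t * tker N (fun=> 0%N) x y).
    move=> Iu; have Iuc : L1 P (fun y => u y * cutoff c t).
      by under eq_fun do rewrite mulrC; exact: L1Z.
    exact: (L1_kernel mk hC x Iuc).
  transitivity (\int[P]_y (U1 (t, y) * cutoff c t * tker N (fun=> 0%N) x y) -
                \int[P]_y (U2 (t, y) * cutoff c t * tker N (fun=> 0%N) x y)).
    rewrite -(RintegralB measurableT (Ik _ It1) (Ik _ It2)).
    by apply: eq_Rintegral => y _; rewrite /W /=; ring.
  rewrite F1// F2// opprD addrACA subrr add0r.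
  have IF1 := L1_flux n0 c0 cT w1 N x; have IF2 := L1_flux n0 c0 cT w2 N x.
  rewrite -(Rintegral_itv_slicesB t IF1 IF2).
  apply: eq_Rintegral => s _; apply: eq_Rintegral => y _.
  by rewrite /W /g /flux /U1 /U2 /=; ring.
have pos z : 0 < z.1 < c -> 0 <= g z * beta (W z) /\
    (g z * beta (W z) = 0 -> U1 z = U2 z).
  move=> zc; have k0 := cutoff_gt0 zc; have d0 := dcutoff_lt0 zc.
  have j0 := jap_gt0 (W z).
  have f0 := odd_power_monotone (U1 z) (U2 z) on.
  have -> : g z * beta (W z) = cutoff c z.1 / jap (W z) *
    (cutoff c z.1 * ((U1 z - U2 z) * (U1 z ^+ n - U2 z ^+ n))
     + (- dcutoff c z.1) * (U1 z - U2 z) ^+ 2).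
    by rewrite /beta; set j := jap (W z); rewrite /W /g; ring.
  have a0 : 0 <= cutoff c z.1 * ((U1 z - U2 z) * (U1 z ^+ n - U2 z ^+ n)).
    by rewrite mulr_ge0// ltW.
  have b0 : 0 <= - dcutoff c z.1 * (U1 z - U2 z) ^+ 2.
    by rewrite mulr_ge0 ?sqr_ge0// oppr_ge0 ltW.
  split.
    by apply: mulr_ge0; [apply: divr_ge0; exact: ltW|exact: addr_ge0].
  move/eqP; rewrite mulf_eq0 gt_eqF ?divr_gt0//= paddr_eq0// => /andP[_].
  rewrite mulf_eq0 oppr_eq0 lt_eqF//= sqrf_eq0 subr_eq0.
  by move/eqP.
have ge0 z : 0 <= g z * beta (W z).
  have [/pos[]//|zc] := boolP (0 < z.1 < c).
  by case: z zc => s y sc; rewrite (out s sc).2 mul0r.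
have := nonlinear_term_ae0 IW Ig c0 cT (fun s y sc => (out s sc).1 y)
  (fun s y sc => (out s sc).2 y) weak ge0.
apply: filterS => z gb0 zc; have [_ /(_ gb0)] := pos z zc.
have zT : 0 < z.1 < T by case/andP: zc => -> zc; exact: lt_trans cT.
by rewrite /U1 /U2 /trunc zT.
Qed.

End difference.

Theorem theorem4p1 (R : realType) (d n : nat) (uin : Rpt R d -> R)
    (u1 u2 : measurableTypeR R -> Rpt R d -> R) :
  (1 <= d)%N -> odd n -> (3 <= n)%N ->
  in_Ln n uin ->
  weak_solution n uin u1 -> weak_solution n uin u2 ->
  {ae (@lebesgue_measure R \x torus_measure R d)%E,
     forall z : measurableTypeR R * Rpt R d,
       0 < z.1 -> u1 z.1 z.2 = u2 z.1 z.2}.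
Proof.
move=> _ on _ _ w1 w2.
have window (k : nat) := uniqueness_window on (ltr0Sn R k) w1 w2.
apply: filterS (ae_foralln window) => z uz z0.
apply: (uz (Num.truncn z.1)); rewrite z0/=; exact: truncnS_gt.
Qed.
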